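(* Let $\underline{T}=(T_1,\dots,T_k)$ be a tuple of contractions on a Hilbert space $\mathcal{H}$ and $q_{ij}\in\mathbb{T}$ ($1\le i<j\le k$) with $T_iT_j=q_{ij}T_jT_i$ for $i<j$. Then $\underline{T}$ admits a regular $q$-unitary dilation in each of the following cases: (1) each $T_i$ is an isometry; (2) $\underline{T}$ is doubly $q$-commuting, i.e. additionally $T_iT_j^*=\overline{q_{ij}}\,T_j^*T_i$ for $i<j$; (3) $\|T_1\|^2+\dots+\|T_k\|^2\le1$.
   Context: Set $q_{ji}=q_{ij}^{-1}$. For an integer $m$, $m^+=\max\{m,0\}$, $m^-=-\min\{m,0\}$. The tuple $\underline{T}$ admits a regular $q$-unitary dilation if there exist a Hilbert space $\mathcal{K}\supseteq\mathcal{H}$ and unitaries $U_1,\dots,U_k$ on $\mathcal{K}$ with $U_iU_j=q_{ij}U_jU_i$ for all $i\ne j$, such that for all distinct $\alpha_1,\dots,\alpha_r\in\{1,\dots,k\}$ and all $m_{\alpha_1},\dots,m_{\alpha_r}\in\mathbb{Z}$, \[ \prod_{1\le i<j\le r}q_{\alpha_i\alpha_j}^{-m_{\alpha_i}^+m_{\alpha_j}^-}\big[(T_{\alpha_1}^{m_{\alpha_1}^-})^*\cdots(T_{\alpha_r}^{m_{\alpha_r}^-})^*\big]\big[T_{\alpha_1}^{m_{\alpha_1}^+}\cdots T_{\alpha_r}^{m_{\alpha_r}^+}\big]=P_{\mathcal{H}}U_{\alpha_1}^{m_{\alpha_1}}\cdots U_{\alpha_r}^{m_{\alpha_r}}|_{\mathcal{H}},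 \] where $P_{\mathcal{H}}$ is the orthogonal projection of $\mathcal{K}$ onto $\mathcal{H}$. *)

(* Defs.v *)
From HB Require Import structures.
From mathcomp Require Import all_boot all_order all_algebra.
From mathcomp Require Import classical_sets boolp reals.
From mathcomp Require Import complex.
Set Implicit Arguments. Unset Strict Implicit. Unset Printing Implicit Defensive.
Import Order.TTheory GRing.Theory Num.Theory.
Local Open Scope ring_scope.

Record hilbert (R : realType) := Hilbert {
  hcarrier :> lmodType R[i];
  hdot : hcarrier -> hcarrier -> R[i];
  hdotDl : forall (a : R[i]) (x y z : hcarrier),
      hdot (a *: x + y) z = a * hdot x z + hdot y z;
  hdotC : forall x y : hcarrier, hdot y x = (hdot x y)^*;
  hdot_ge0 : forall x : hcarrier, 0 <= hdot x x;
  hdot_eq0 : forall x : hcarrier, hdot x x = 0 -> x = 0;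
  hcomplete : forall u : nat -> hcarrier,
      (forall e : R, 0 < e -> exists N : nat, forall m n : nat, (N <= m)%N -> (N <= n)%N ->
          Num.sqrt (complex.Re (hdot (u m - u n) (u m - u n))) < e) ->
      exists l : hcarrier, forall e : R, 0 < e -> exists N : nat, forall n : nat, (N <= n)%N ->
          Num.sqrt (complex.Re (hdot (u n - l) (u n - l))) < e
}.

Section Ops.
Variable R : realType.

Definition hnorm (H : hilbert R) (x : H) : R := Num.sqrt (complex.Re (hdot x x)).

Definition is_linear (H K : hilbert R) (T : H -> K) :=
  forall (a : R[i]) (x y : H), T (a *: x + y) = a *: T x + T y.

Definition hcontraction (H : hilbert R) (T : H -> H) :=
  is_linear T /\ forall x : H, hnorm (T x) <= hnorm x.

Definition is_adjoint (H : hilbert R) (T S : H -> H) :=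
  forall x y : H, hdot (T x) y = hdot x (S y).

Definition hisometry (H K : hilbert R) (V : H -> K) :=
  is_linear V /\ forall x : H, hnorm (V x) = hnorm x.

Definition unitary_with_inv (K : hilbert R) (U Ui : K -> K) :=
  hisometry U /\ cancel U Ui /\ cancel Ui U.

Definition opnorm (H : hilbert R) (T : H -> H) : R :=
  sup [set hnorm (T x) | x in [set x : H | hnorm x <= 1]].

Definition orth_proj_range (H K : hilbert R) (V : H -> K) (z y : K) :=
  (exists h : H, y = V h) /\ forall h : H, hdot (z - y) (V h) = 0.

End Ops.

Definition opprod (X : Type) (fs : seq (X -> X)) : X -> X :=
  foldr (fun f g => f \o g) id fs.

Definition ipos (m : int) : nat := if m is Posz n then n else 0%N.
Definition ineg (m : int) : nat := if m is Negz n then n.+1 else 0%N.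

Definition zpow (X : Type) (U Ui : X -> X) (m : int) : X -> X :=
  match m with Posz n => iter n U | Negz n => iter n.+1 Ui end.

(* q_ij given for i < j; q_ji := q_ij^{-1} (value on the diagonal irrelevant) *)
Definition qfull (R : realType) (k : nat) (q : 'I_k -> 'I_k -> R[i]) (i j : 'I_k) : R[i] :=
  if (i < j)%N then q i j else if (j < i)%N then (q j i)^-1 else 1.

(* Regular q-unitary dilation of T (Ts i is the adjoint of T i). *)
Definition regular_q_unitary_dilation (R : realType) (H : hilbert R) (k : nat)
  (q : 'I_k -> 'I_k -> R[i]) (T Ts : 'I_k -> H -> H) :=
  exists (K : hilbert R) (V : H -> K) (U Ui : 'I_k -> K -> K),
    (* K contains H, via the isometric embedding V *)
    hisometry V /\
    (forall i, unitary_with_inv (U i) (Ui i)) /\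
    (forall i j : 'I_k, i != j -> forall x : K, U i (U j x) = qfull q i j *: U j (U i x)) /\
    (forall (r : nat) (alpha : 'I_r -> 'I_k) (m : 'I_r -> int), injective alpha ->
       forall x : H,
       orth_proj_range V
         (opprod [seq zpow (U (alpha i)) (Ui (alpha i)) (m i) | i <- enum 'I_r] (V x))
         (V ((\prod_(i < r) \prod_(j < r | (i < j)%N)
                 (qfull q (alpha i) (alpha j) ^+ (ipos (m i) * ineg (m j)))^-1) *:
             opprod [seq iter (ineg (m i)) (Ts (alpha i)) | i <- enum 'I_r]
               (opprod [seq iter (ipos (m i)) (T (alpha i)) | i <- enum 'I_r] x)))).

(* Main.v *)
(* A tuple admits a regular q-unitary dilation as soon as Brehmer's forms
   sum_(v in u) (-1)^|v| <T_v x, T_v y> are all positive semidefinite.  The tuple is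
   dilated one variable at a time on spaces that only carry a positive semidefinite
   form: T_i becomes the shift on finitely supported sequences int -> E, with form
   sum_(a,b) <T_i^((a-b)^+) f_a, T_i^((b-a)^+) g_b>, and T_j becomes
   f |-> (q_ji^n T_j f_n)_n.  The twist by q_ji^n makes each Brehmer form of the new
   tuple the Toeplitz form of the old one, so positivity is inherited, and so is
   unitarity of the variables treated earlier.  Only after the last variable does one
   pass to the quotient and completion.  Regularity of the dilation is the
   statement that <T_v x, T_w y> is preserved for words v, w without common letter. *)
Require Import Defs.
From HB Require Import structures.
From mathcomp Require Import all_boot all_order all_algebra.
From mathcomp Require Import classical_sets boolp functions reals.
From mathcomp Require Import complex.
From mathcomp Require Import ring lra zify.
Set Implicit Arguments. Unset Strict Implicit. Unset Printing Implicit Defensive.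
Import Order.TTheory GRing.Theory Num.Theory.
Local Open Scope ring_scope.
Import Normc.
Local Notation Re := complex.Re.
Local Notation Im := complex.Im.

(** * Hermitian forms *)

(** Brehmer's forms apply operators to both arguments and never mention an adjoint, so they make
    sense on a space that is neither separated nor complete. This is what allows the induction to
    postpone the completion: on finitely supported sequences the shift is bijective, and a twisted
    [T_j] is bijective as soon as [T_j] is, so that unitary can be read as isometric and bijective
    even for a degenerate form. All subsets of the variables have to enter the condition. The
    Toeplitz form of the Brehmer form of [w] is positive when [T_i] is contractive for the latter,
    and this contractivity is exactly the Brehmer condition of [i :: w]. Words without common letter
    suffice for regularity because the inverse of a unitary is its adjoint: in the inner product of
    a product of powers of the [U_i] with a vector of the embedded space, the negative powers move
    to the other argument, and no variable has both a positive and a negative power. *)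

Section Scalars.
Variable R : realType.
Implicit Types (z w : R[i]).

Lemma conjE z : z^* = conjc z. Proof. by []. Qed.
Lemma conj_real (a : R) : (a%:C%C)^* = a%:C%C :> R[i].
Proof. by rewrite conjE conjc_real. Qed.
Lemma ReD z w : Re (z + w) = Re z + Re w. Proof. by case: z; case: w. Qed.
Lemma ReN z : Re (- z) = - Re z. Proof. by case: z. Qed.
Lemma ReB z w : Re (z - w) = Re z - Re w. Proof. by rewrite ReD ReN. Qed.
Lemma ImD z w : Im (z + w) = Im z + Im w. Proof. by case: z; case: w. Qed.
Lemma ImN z : Im (- z) = - Im z. Proof. by case: z. Qed.
Lemma Re_conj z : Re (z^*) = Re z. Proof. by case: z. Qed.
Lemma Re_mulrC (a : R) z : Re (a%:C%C * z) = a * Re z.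
Proof. by case: z => x y /=; rewrite mul0r subr0. Qed.
Lemma mul_conj z : z * z^* = (normc z ^+ 2)%:C%C.
Proof.
case: z => x y; rewrite conjE /= sqr_sqrtr ?addr_ge0 ?sqr_ge0 //.
by apply/eqP; rewrite eq_complex /=; apply/andP; split; apply/eqP; ring.
Qed.
Lemma normc_ge0 z : 0 <= normc z. Proof. by case: z => x y; exact: sqrtr_ge0. Qed.
Lemma normc_conj z : normc (z^*) = normc z.
Proof. by case: z => x y /=; rewrite sqrrN. Qed.
Lemma Re_le_normc z : `|Re z| <= normc z.
Proof.
case: z => x y /=; rewrite -sqrtr_sqr ler_wsqrtr // lerDl sqr_ge0 //.
Qed.
Lemma Im_le_normc z : `|Im z| <= normc z.
Proof.
case: z => x y /=; rewrite -sqrtr_sqr ler_wsqrtr // lerDr sqr_ge0 //.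
Qed.
Lemma normc_le z : normc z <= `|Re z| + `|Im z|.
Proof.
case: z => x y /=; rewrite -[leRHS]ger0_norm ?addr_ge0 // -sqrtr_sqr ler_wsqrtr //.
by rewrite sqrrD !real_normK ?num_real // -addrA lerD2l lerDr mulrn_wge0 ?mulr_ge0.
Qed.
Lemma normcD z w : normc (z + w) <= normc z + normc w.
Proof. exact: le_normcD. Qed.
Lemma normcB z w : normc (z - w) = normc (w - z).
Proof. by rewrite -normcN opprB. Qed.
End Scalars.

Section HermitianForms.
Variables (R : realType) (E : lmodType R[i]).
Implicit Types (B : E -> E -> R[i]).

Record hform B : Prop := Hform {
  hfl : forall a x y z, B (a *: x + y) z = a * B x z + B y z;
  hfC : forall x y, B y x = (B x y)^* }.

Definition qf B x : R := Re (B x x).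
Definition psd B := forall x, 0 <= qf B x.
Definition nf B x : R := Num.sqrt (qf B x).

Section Form.
Variables (B : E -> E -> R[i]) (hB : hform B).

Lemma hf0l y : B 0 y = 0.
Proof. by have := hfl hB (-1) 0 0 y; rewrite scaler0 addr0 mulN1r addNr. Qed.
Lemma hf0r y : B y 0 = 0. Proof. by rewrite (hfC hB 0 y) hf0l rmorph0. Qed.
Lemma hfDl x y z : B (x + y) z = B x z + B y z.
Proof. by rewrite -{1}(scale1r x) (hfl hB) mul1r. Qed.
Lemma hfZl a x z : B (a *: x) z = a * B x z.
Proof. by rewrite -{1}(addr0 (a *: x)) (hfl hB) hf0l addr0. Qed.
Lemma hfDr x y z : B z (x + y) = B z x + B z y.
Proof. by rewrite (hfC hB (x + y)) (hfC hB x z) (hfC hB y z) hfDl rmorphD. Qed.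
Lemma hfZr a x z : B z (a *: x) = a^* * B z x.
Proof. by rewrite (hfC hB (a *: x)) (hfC hB x z) hfZl rmorphM. Qed.
Lemma hfNl x z : B (- x) z = - B x z.
Proof. by rewrite -scaleN1r hfZl mulN1r. Qed.
Lemma hfNr x z : B z (- x) = - B z x.
Proof. by rewrite (hfC hB (- x)) (hfC hB x z) hfNl rmorphN. Qed.
Lemma hfBl x y z : B (x - y) z = B x z - B y z.
Proof. by rewrite hfDl hfNl. Qed.
Lemma hfBr x y z : B z (x - y) = B z x - B z y.
Proof. by rewrite hfDr hfNr. Qed.
Lemma hf_self x : B x x = (qf B x)%:C%C.
Proof.
have := hfC hB x x; rewrite /qf; case: (B x x) => u v [] h /=.
by congr Complex; lra.
Qed.
Lemma qfD x y : qf B (x + y) = qf B x + 2 * Re (B x y) + qf B y.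
Proof.
rewrite /qf hfDl !hfDr !ReD (hfC hB x y) Re_conj; ring.
Qed.
Lemma qfZ a x : qf B (a *: x) = normc a ^+ 2 * qf B x.
Proof. by rewrite /qf hfZl hfZr mulrA mul_conj Re_mulrC. Qed.
Hypothesis pB : psd B.

Lemma nf_ge0 x : 0 <= nf B x. Proof. exact: sqrtr_ge0. Qed.
Lemma nf_sq x : nf B x ^+ 2 = qf B x. Proof. exact: sqr_sqrtr. Qed.

Lemma cauchy_schwarz_sq x y : normc (B x y) ^+ 2 <= qf B x * qf B y.
Proof.
set b := B x y; set n := normc b ^+ 2.
have n0 : 0 <= n by rewrite sqr_ge0.
(* Positivity at [x - t b y]; including [b] in the coefficient makes the cross term real. *)
have key (t : R) : 0 <= qf B x - 2 * t * n + t ^+ 2 * n * qf B y.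
  have := pB (x + (- (t%:C%C * b)) *: y).
  rewrite qfD qfZ hfZr normcN normcM rmorphN rmorphM -/b /=.
  have -> : - ((t%:C%C)^* * b^*) * b = (- (t * n))%:C%C.
    rewrite /n conj_real mulNr -mulrA [_^* * _]mulrC mul_conj -rmorphM -rmorphN //.
  rewrite /= expr0n addr0 sqrtr_sqr exprMn real_normK ?num_real // -/n /=.
  by move=> h; apply: le_trans h _; rewrite le_eqVlt; apply/orP; left; apply/eqP; ring.
have := pB y; rewrite le_eqVlt => /orP[/eqP y0|y0].
  (* Null vectors exist, since the form is only semidefinite. For such [y] the bound [key] is affine
     in [t] with slope [- 2 * n], and a large [t] would violate it if [n] were positive. *)
  rewrite -y0 mulr0; have [//|nn] := leP n 0.
  have := key (qf B x / n); rewrite -y0 mulr0 addr0.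
  have -> : 2 * (qf B x / n) * n = 2 * qf B x by field; lra.
  have := key ((1 + qf B x) / n); rewrite -y0 mulr0 addr0.
  have -> : 2 * ((1 + qf B x) / n) * n = 2 * (1 + qf B x) by field; lra.
  by have := pB x; lra.
have := key (qf B y)^-1.
have -> : qf B x - 2 * (qf B y)^-1 * n + (qf B y)^-1 ^+ 2 * n * qf B y =
          (qf B x * qf B y - n) / qf B y by field; lra.
by rewrite pmulr_lge0 ?invr_gt0 // subr_ge0.
Qed.

Lemma cauchy_schwarz x y : normc (B x y) <= nf B x * nf B y.
Proof.
rewrite -(@ler_pXn2r _ 2) ?nnegrE ?normc_ge0 ?mulr_ge0 ?nf_ge0 //.
by rewrite exprMn !nf_sq cauchy_schwarz_sq.
Qed.

Lemma nfD x y : nf B (x + y) <= nf B x + nf B y.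
Proof.
rewrite -(@ler_pXn2r _ 2) ?nnegrE ?addr_ge0 ?nf_ge0 // nf_sq qfD sqrrD !nf_sq.
have := le_trans (le_trans (ler_norm _) (Re_le_normc (B x y))) (cauchy_schwarz x y).
lra.
Qed.
Lemma nfZ a x : nf B (a *: x) = normc a * nf B x.
Proof.
by rewrite /nf qfZ sqrtrM ?sqr_ge0 // sqrtr_sqr ger0_norm // normc_ge0.
Qed.
End Form.
End HermitianForms.

Definition lin (R : realType) (E F : lmodType R[i]) (f : E -> F) :=
  forall a x y, f (a *: x + y) = a *: f x + f y.

Section Linear.
Variables (R : realType) (E F : lmodType R[i]) (f : E -> F) (hf : lin f).
Lemma lin0 : f 0 = 0.
Proof. by have := hf (-1) 0 0; rewrite scaler0 addr0 scaleN1r addNr. Qed.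
Lemma linD x y : f (x + y) = f x + f y.
Proof. by rewrite -{1}(scale1r x) hf scale1r. Qed.
Lemma linZ a x : f (a *: x) = a *: f x.
Proof. by rewrite -{1}(addr0 (a *: x)) hf lin0 addr0. Qed.
End Linear.

Lemma lin_iter (R : realType) (E : lmodType R[i]) (f : E -> E) n :
  lin f -> lin (iter n f).
Proof. by move=> hf; elim: n => [|n IH] a x y //=; rewrite IH hf. Qed.

(** * Positivity of the Toeplitz kernel of a contraction *)

Section Toeplitz.
Variables (R : realType) (E : lmodType R[i]) (C : E -> E -> R[i]) (T : E -> E).
Hypotheses (hC : hform C) (hT : lin T) (pC : psd C).
Hypothesis cT : forall x, qf C (T x) <= qf C x.

Let P (h : nat -> E) N : E := \sum_(0 <= a < N) iter a T (h a).

Lemma hform_suml (r : seq nat) (F : nat -> E) y :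
  C (\sum_(a <- r) F a) y = \sum_(a <- r) C (F a) y.
Proof.
by elim: r => [|a r IH]; rewrite ?big_nil ?(hf0l hC) // !big_cons (hfDl hC) IH.
Qed.
Lemma hform_sumr (r : seq nat) (F : nat -> E) y :
  C y (\sum_(a <- r) F a) = \sum_(a <- r) C y (F a).
Proof.
by elim: r => [|a r IH]; rewrite ?big_nil ?(hf0r hC) // !big_cons (hfDr hC) IH.
Qed.

Lemma lin_sum (r : seq nat) (F : nat -> E) :
  T (\sum_(a <- r) F a) = \sum_(a <- r) T (F a).
Proof.
by elim: r => [|a r IH]; rewrite ?big_nil ?(lin0 hT) // !big_cons (linD hT) IH.
Qed.

(* Writing g := h_0 + T h_1 + T^2 h_2 + ..., the Toeplitz sum telescopes into
   |g_0|^2 + sum (|g_n|^2 - |T g_n|^2), where g_n belongs to the shifted sequence. *)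
Lemma toeplitz_psd_nat N (h : nat -> E) :
  0 <= Re (\sum_(0 <= a < N) \sum_(0 <= b < N)
             C (iter (a - b) T (h a)) (iter (b - a) T (h b))).
Proof.
apply: le_trans (pC (P h N)) _.
elim: N h => [|N IH] h; first by rewrite /P !big_geq // /qf (hf0l hC).
have PS : P h N.+1 = h 0%N + T (P (fun a => h a.+1) N).
  rewrite /P big_nat_recl //= lin_sum; congr (_ + _).
set g := P (fun a => h a.+1) N in PS.
rewrite PS (qfD hC) big_nat_recl // big_nat_recl // ReD ReD subnn /=.
have -> : \sum_(0 <= i < N) C (h 0%N) (iter (i.+1 - 0) T (h i.+1)) = C (h 0%N) (T g).
  rewrite /g /P lin_sum hform_sumr; by apply: eq_bigr => i _; rewrite subn0.
have -> : \sum_(0 <= i < N) \sum_(0 <= b < N.+1)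
     C (iter (i.+1 - b) T (h i.+1)) (iter (b - i.+1) T (h b)) =
   \sum_(0 <= i < N) (C (iter i.+1 T (h i.+1)) (h 0%N) +
     \sum_(0 <= b < N) C (iter (i - b) T (h i.+1)) (iter (b - i) T (h b.+1))).
  by apply: eq_bigr => i _; rewrite big_nat_recl // subn0.
rewrite big_split ReD.
have -> : \sum_(0 <= i < N) C (iter i.+1 T (h i.+1)) (h 0%N) =
    C (T g) (h 0%N).
  rewrite /g /P lin_sum hform_suml; by apply: eq_bigr.
have := IH (fun a => h a.+1); have := cT g; rewrite -/g /qf.
rewrite (hfC hC (h 0%N) (T g)) Re_conj; lra.
Qed.
End Toeplitz.

(** * Toeplitz forms on finitely supported sequences *)

(** Turns a [Prop]-valued linear condition into a module. It serves twice: for finitely supported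
    sequences and for the functionals that form the completion. *)
Record submodule (K : nzRingType) (V : lmodType K) := Submodule {
  sm_mem :> V -> Prop;
  sm_mem0 : sm_mem 0;
  sm_memL : forall a x y, sm_mem x -> sm_mem y -> sm_mem (a *: x + y) }.

Section Submodules.
Variables (K : nzRingType) (V : lmodType K) (S : submodule V).

Definition sm_pred : {pred V} := [pred x | `[< S x >]].

Lemma sm_closed : subsemimod_closed sm_pred.
Proof.
split; [split|].
- exact/asboolP/sm_mem0.
- move=> x y /asboolP hx /asboolP hy; apply/asboolP.
  by rewrite -(scale1r x); apply: sm_memL.
- move=> a x /asboolP hx; apply/asboolP.
  by rewrite -(addr0 (a *: x)); apply: sm_memL => //; apply: sm_mem0.
Qed.

HB.instance Definition _ := GRing.isSubmodClosed.Build K V sm_pred sm_closed.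

Record sm_type := SmType { sm_val : V; _ : sm_val \in sm_pred }.

HB.instance Definition _ := [isSub for sm_val].
HB.instance Definition _ := [Choice of sm_type by <:].
HB.instance Definition _ := [SubChoice_isSubLmodule of sm_type by <:].

Definition sm_mk (x : V) (hx : S x) : sm_type := SmType (asboolT hx).

Lemma sm_valP (u : sm_type) : S (sm_val u).
Proof. by case: u => x /= /asboolP. Qed.

Lemma sm_val_inj : injective sm_val. Proof. exact: val_inj. Qed.

Lemma sm_valL a (u v : sm_type) : sm_val (a *: u + v) = a *: sm_val u + sm_val v.
Proof. exact: (linearP (val : sm_type -> V)). Qed.
End Submodules.

Section FiniteSupport.
Variables (R : realType) (E : lmodType R[i]).

Definition fin_supp (f : int -> E) := exists r : seq int, forall n, n \notin r -> f n = 0.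

Lemma fin_supp0 : fin_supp 0. Proof. by exists [::]. Qed.

Lemma fin_suppL a (f g : int -> E) : fin_supp f -> fin_supp g -> fin_supp (a *: f + g).
Proof.
move=> [r hr] [s hs]; exists (r ++ s) => n; rewrite mem_cat negb_or => /andP[nr ns].
have -> : (a *: f + g) n = a *: f n + g n by [].
rewrite (hr _ nr) (hs _ ns) scaler0.
by rewrite addr0.
Qed.

Definition fseq := sm_type (Submodule fin_supp0 fin_suppL).

Definition fmk (f : int -> E) (hf : fin_supp f) : fseq :=
  sm_mk (S := Submodule fin_supp0 fin_suppL) hf.

Definition fval (f : fseq) : int -> E := sm_val f.
#[global] Arguments fval : simpl never.

Lemma fvalP f : fin_supp (fval f). Proof. exact: (sm_valP f). Qed.
Lemma fvalL a (f g : fseq) n : fval (a *: f + g) n = a *: fval f n + fval g n.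
Proof. by rewrite /fval sm_valL. Qed.
Lemma fval_inj (f g : fseq) : (forall n, fval f n = fval g n) -> f = g.
Proof. by move=> h; apply: sm_val_inj; apply/funext. Qed.
Lemma fvalZ a (f : fseq) n : fval (a *: f) n = a *: fval f n.
Proof.
rewrite -[a *: f]addr0 fvalL; suff -> : fval 0 n = 0 by rewrite addr0.
by have := fvalL (-1) 0 0 n; rewrite scaler0 addr0 scaleN1r addNr.
Qed.

Definition supp (f : fseq) : seq int := undup (projT1 (cid (fvalP f))).

Definition covers (r : seq int) (f : fseq) := uniq r /\ forall n, n \notin r -> fval f n = 0.

Lemma supp_covers f : covers (supp f) f.
Proof.
split; first exact: undup_uniq.
by move=> n; rewrite mem_undup; case: (cid _) => r /= hr /hr.
Qed.

Lemma coversW r s f : covers r f -> uniq s -> {subset r <= s} -> covers s f.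
Proof. by move=> [_ h] us rs; split=> // n ns; apply: h; apply: contra ns => /rs. Qed.

Lemma big_uniq_support (r s : seq int) (F : int -> R[i]) : uniq r -> uniq s ->
  (forall n, n \notin r -> F n = 0) -> (forall n, n \notin s -> F n = 0) ->
  \sum_(n <- r) F n = \sum_(n <- s) F n.
Proof.
move=> ur us hr hs.
have aux (r' s' : seq int) : (forall n, n \notin s' -> F n = 0) ->
    \sum_(n <- r') F n = \sum_(n <- [seq n <- r' | n \in s']) F n.
  move=> h; rewrite big_filter [LHS](bigID (mem s')) /=.
  by rewrite [X in _ + X]big1 ?addr0 // => n nn; exact: h.
rewrite (aux r s hs) (aux s r hr).
apply: perm_big; apply: uniq_perm; rewrite ?filter_uniq //.
by move=> n; rewrite !mem_filter andbC.
Qed.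

Section Kernel.
Variables (C : E -> E -> R[i]) (T : E -> E).

Definition toep_on r s (f g : int -> E) : R[i] := \sum_(a <- r) \sum_(b <- s)
  C (iter (ipos (a - b)) T (f a)) (iter (ipos (b - a)) T (g b)).

Definition toep (f g : fseq) : R[i] := toep_on (supp f) (supp g) (fval f) (fval g).

Hypotheses (hC : hform C) (hT : lin T).

(** [supp] is an arbitrary choice of index list; by this independence every later computation may
    use the list that suits it. *)
Lemma toepE r s f g : covers r f -> covers s g -> toep f g = toep_on r s (fval f) (fval g).
Proof.
have T0 n : iter n T 0 = 0 by rewrite (lin0 (lin_iter n hT)).
move=> [ur hr] [us hs]; have [uf hf] := supp_covers f; have [ug hg] := supp_covers g.
transitivity (toep_on r (supp g) (fval f) (fval g)).
  apply: big_uniq_support => // n /[dup] nn; [move/hf|move/hr] => h;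
  by rewrite big1 // => b _; rewrite h T0 (hf0l hC).
apply: eq_bigr => a _; apply: big_uniq_support => // n; [move/hg|move/hs] => h;
by rewrite h T0 (hf0r hC).
Qed.

Lemma toep_hform : hform toep.
Proof.
split=> [c f f' g|f g].
  pose r := undup (supp f ++ supp f' ++ supp (c *: f + f')).
  have cov h : {subset supp h <= r} -> covers r h.
    by apply: coversW (supp_covers h) _; exact: undup_uniq.
  have [cf cf' ca] : [/\ covers r f, covers r f' & covers r (c *: f + f')].
    by split; apply: cov => n; rewrite /r mem_undup !mem_cat => ->; rewrite ?orbT.
  rewrite (toepE ca (supp_covers g)) (toepE cf (supp_covers g)) (toepE cf' (supp_covers g)).
  rewrite /toep_on mulr_sumr -big_split; apply: eq_bigr => a _ /=.
  rewrite mulr_sumr -big_split; apply: eq_bigr => b _ /=.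
  by rewrite fvalL (lin_iter _ hT) (hfl hC).
rewrite /toep /toep_on exchange_big rmorph_sum; apply: eq_bigr => a _ /=.
by rewrite rmorph_sum; apply: eq_bigr => b _ /=; rewrite -(hfC hC).
Qed.
End Kernel.

Lemma ipos_subn (a b : nat) (M : int) : ipos (a%:Z + M - (b%:Z + M)) = (a - b)%N.
Proof.
rewrite (_ : _ - _ = a%:Z - b%:Z); last by lia.
case: (leqP b a) => h; first by rewrite subzn.
have -> : (a - b = 0)%N by lia.
rewrite (_ : a%:Z - b%:Z = Negz (b - a).-1) //; lia.
Qed.

Lemma toep_psd C T : hform C -> lin T -> psd C -> (forall x, qf C (T x) <= qf C x) ->
  psd (toep C T).
Proof.
move=> hC hT pC cT f; rewrite /qf.
(* The kernel sees only differences of indices, so enclosing the support in an interval and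
   translating it to start at 0 reduces the claim to sums over natural numbers. *)
have [M [N hMN]] : exists M : int, exists N : nat,
    forall n, n \in supp f -> M <= n < M + N%:Z.
  elim: (supp f) => [|a r [M [N IH]]]; first by exists 0, 0%N.
  exists (Num.min M a), (`|M| + `|a| + N + `|a| + `|M|).+1%N => n.
  by rewrite inE => /orP[/eqP ->|/IH]; lia.
have [uf hf] := supp_covers f.
have cov : covers [seq n%:Z + M | n <- iota 0 N] f.
  split; first by rewrite map_inj_uniq ?iota_uniq // => a b; lia.
  move=> n nn; apply: hf; apply: contra nn => /hMN h; apply/mapP.
  by exists `|(n - M)%R|%N; [rewrite mem_iota|]; lia.
rewrite (toepE hC hT cov cov) /toep_on big_map.
have := toeplitz_psd_nat hC hT pC cT N (fun n => fval f (n%:Z + M)).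
rewrite /index_iota subn0; congr (_ <= Re _).
apply: eq_bigr => a _; rewrite big_map; apply: eq_bigr => b _.
by rewrite !ipos_subn.
Qed.
End FiniteSupport.

(** * Dilating one variable *)

Section QTuples.
Variables (R : realType) (I : eqType) (Q : I -> I -> R[i]).

Record qtuple (E : lmodType R[i]) (T : I -> E -> E) : Prop := Qtuple {
  qlin : forall i, lin (T i);
  qcomm : forall i j x, T i (T j x) = Q i j *: T j (T i x) }.

(* The form x, y |-> sum over v in w of (-1)^|v| B (T_v x) (T_v y). *)
Fixpoint defect (E : lmodType R[i]) (B : E -> E -> R[i]) (T : I -> E -> E) (w : seq I) x y :=
  if w is j :: w' then defect B T w' x y - defect B T w' (T j x) (T j y) else B x y.

(** Duplicate-free words stand for subsets. For a q-commuting tuple with unimodular coefficients,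
    reordering a word multiplies [T_v] by a phase, which cancels between the two arguments of the
    form. *)
Definition brehmer (E : lmodType R[i]) (B : E -> E -> R[i]) (T : I -> E -> E) :=
  forall w, uniq w -> psd (defect B T w).

Definition isometric (E : lmodType R[i]) (B : E -> E -> R[i]) (U : E -> E) :=
  forall x y, B (U x) (U y) = B x y.

Lemma defect_hform (E : lmodType R[i]) (B : E -> E -> R[i]) T w :
  hform B -> (forall i, lin (T i)) -> hform (defect B T w).
Proof.
move=> hB hT; elim: w => [//|j w IH]; split=> [a x y z|x y] /=.
  by rewrite hT !(hfl IH); ring.
by rewrite (hfC IH x) (hfC IH (T j x)) rmorphB.
Qed.

Hypothesis Qu : forall i j, Q i j * (Q i j)^* = 1.
Hypothesis Q_diag : forall i, Q i i = 1.
Hypothesis QC : forall i j, Q i j * Q j i = 1.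

Lemma Q_neq0 i j : Q i j != 0.
Proof.
apply: contraTneq isT => h; have := QC i j.
by rewrite h mul0r => /eqP; rewrite eq_sym oner_eq0.
Qed.
Lemma Q_inv i j : Q j i = (Q i j)^-1.
Proof. by apply: (mulfI (Q_neq0 i j)); rewrite QC divff // Q_neq0. Qed.
Lemma Q_conj i j : (Q i j)^* = Q j i.
Proof. by apply: (mulfI (Q_neq0 i j)); rewrite QC Qu. Qed.
Lemma Q_conj_expz i j (n : int) : (Q i j ^ n)^* = Q j i ^ n.
Proof.
by rewrite -(Q_conj i j) fmorphXz.
Qed.

Lemma qcomm_iter (E : lmodType R[i]) (T : I -> E -> E) i j n x : qtuple T ->
  iter n (T i) (T j x) = Q i j ^+ n *: T j (iter n (T i) x).
Proof.
move=> qT; elim: n => [|n IH] /=; first by rewrite scale1r.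
by rewrite IH (linZ (qlin qT i)) (qcomm qT) scalerA exprSr.
Qed.

Definition pull (w : seq I) i : seq I := [seq j <- w | j != i].

Fixpoint pull_coef (w : seq I) i : R[i] :=
  if w is j :: w' then pull_coef w' i * (if j == i then 1 else Q j i ^+ count_mem i w') else 1.

(** The scalar depends only on the word and on [Q]. It is therefore the same for a tuple and for its
    dilation, and drops out when the two are compared. *)
Lemma foldr_pull (E : lmodType R[i]) (T : I -> E -> E) w i x : qtuple T ->
  foldr T x w = pull_coef w i *: iter (count_mem i w) (T i) (foldr T x (pull w i)).
Proof.
move=> qT; elim: w => [|j w IH] /=; first by rewrite scale1r.
rewrite IH (linZ (qlin qT j)); case: eqP => [->|/eqP ji] /=; first by rewrite mulr1.
rewrite add0n.
rewrite qcomm_iter // !scalerA -mulrA -exprMn QC.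
by rewrite expr1n mulr1.
Qed.

Lemma mem_pull w i : i \notin pull w i.
Proof. by rewrite mem_filter eqxx. Qed.
Definition word_dilation (E F : lmodType R[i]) (B : E -> E -> R[i]) (T : I -> E -> E)
   (B' : F -> F -> R[i]) (T' : I -> F -> F) (V : E -> F) :=
  forall w1 w2 x y, (forall a, a \in w1 -> a \notin w2) ->
  B' (foldr T' (V x) w1) (foldr T' (V y) w2) = B (foldr T x w1) (foldr T y w2).

Section Step.
Variables (E : lmodType R[i]) (B : E -> E -> R[i]) (T : I -> E -> E) (i : I).
Hypotheses (hB : hform B) (qT : qtuple T) (bT : brehmer B T).

Lemma shift_fin (f : fseq E) : fin_supp (fun n : int => fval f (n - 1)).
Proof.
have [r hr] := fvalP f; exists [seq n + 1 | n <- r] => n nn; apply: hr.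
by apply: contra nn => h; apply/mapP; exists (n - 1) => //; rewrite subrK.
Qed.
Lemma unshift_fin (f : fseq E) : fin_supp (fun n : int => fval f (n + 1)).
Proof.
have [r hr] := fvalP f; exists [seq n - 1 | n <- r] => n nn; apply: hr.
by apply: contra nn => h; apply/mapP; exists (n + 1) => //; rewrite addrK.
Qed.
Lemma twist_fin (c : int -> R[i]) (S : E -> E) (f : fseq E) : S 0 = 0 ->
  fin_supp (fun n : int => c n *: S (fval f n)).
Proof.
by move=> S0; have [r hr] := fvalP f; exists r => n /hr ->; rewrite S0 scaler0.
Qed.
Lemma delta0_fin (x : E) : fin_supp (fun n : int => if n == 0 then x else 0).
Proof. by exists [:: 0] => n; rewrite inE => /negbTE ->. Qed.

Definition shift (f : fseq E) : fseq E := fmk (shift_fin f).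
Definition unshift (f : fseq E) : fseq E := fmk (unshift_fin f).
Definition twist j (f : fseq E) : fseq E :=
  fmk (twist_fin (fun n => Q j i ^ n) f (lin0 (qlin qT j))).
Definition delta0 (x : E) : fseq E := fmk (delta0_fin x).

Definition dilate j : fseq E -> fseq E := if j == i then shift else twist j.

Lemma fval_shift f n : fval (shift f) n = fval f (n - 1). Proof. by []. Qed.
Lemma fval_unshift f n : fval (unshift f) n = fval f (n + 1). Proof. by []. Qed.
Lemma fval_twist j f n : fval (twist j f) n = Q j i ^ n *: T j (fval f n).
Proof. by []. Qed.
Lemma fval_delta0 x n : fval (delta0 x) n = if n == 0 then x else 0. Proof. by []. Qed.

Lemma dilate_qtuple : qtuple dilate.
Proof.
split=> [j|j l f]; rewrite /dilate.
  case: eqP => _ a f g; apply: fval_inj => n.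
    by rewrite fval_shift !fvalL !fval_shift.
  by rewrite fvalL !fval_twist fvalL (qlin qT) scalerDr !scalerA mulrC.
(* Shifting by one place changes the exponent in [Q m i ^ n] by one, which produces exactly the
   factor of the required relation. *)
have shift_twist m : m != i -> twist m (shift f) = Q m i *: shift (twist m f).
  move=> mi; apply: fval_inj => n.
  rewrite fvalZ fval_shift !fval_twist fval_shift scalerA.
  by rewrite -[in LHS](subrK 1 n) expfzDr ?Q_neq0 // expr1z mulrC subrK.
have [ji|ji] := eqVneq j i; have [li|li] := eqVneq l i.
- by rewrite ji li Q_diag scale1r.
- by rewrite ji shift_twist // scalerA QC scale1r.
- by rewrite li shift_twist.
apply: fval_inj => n.
rewrite fvalZ !fval_twist !(linZ (qlin qT _)) (qcomm qT j l) !scalerA; congr (_ *: _).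
ring.
Qed.

Lemma covers_dilate j r f : j != i -> covers r f -> covers r (dilate j f).
Proof.
move=> /negbTE ji [ur hr]; split=> // n /hr h.
by rewrite /dilate ji fval_twist h (lin0 (qlin qT j)) scaler0.
Qed.

Section Forms.
Variables (C : E -> E -> R[i]) (hC : hform C).

Lemma toep_shift f g : toep C (T i) (shift f) (shift g) = toep C (T i) f g.
Proof.
have cov h : covers [seq n + 1 | n <- supp h] (shift h).
  have [us hs] := supp_covers h; split.
    by rewrite map_inj_uniq // => a b /addIr.
  move=> n nn; rewrite fval_shift; apply: hs; apply: contra nn => hn.
  by apply/mapP; exists (n - 1) => //; rewrite subrK.
rewrite (toepE hC (qlin qT i) (cov f) (cov g)) /toep_on big_map.
apply: eq_bigr => a _; rewrite big_map; apply: eq_bigr => b _.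
by rewrite !fval_shift !addrK !opprD !addrA ![_ + 1 - _]addrAC !addrK.
Qed.

Lemma ipos_diff (a b : int) : (ipos (a - b))%:Z - (ipos (b - a))%:Z = a - b.
Proof. by rewrite -(opprB b a); case: (b - a) => [[|n]|n]; rewrite /ipos /=; lia. Qed.

(** Moving [T_j] out of the powers of [T_i] in the [(a, b)] term costs [Q i j] to the power
    [(a-b)^+ - (b-a)^+ = a - b]; the twists contribute [Q j i] to the power [a - b], and the two
    factors cancel. *)
Lemma toep_dilate j f g : j != i ->
  toep C (T i) (dilate j f) (dilate j g) = toep (fun x y => C (T j x) (T j y)) (T i) f g.
Proof.
move=> ji; have cf := covers_dilate ji (supp_covers f); have cg := covers_dilate ji (supp_covers g).
rewrite (toepE hC (qlin qT i) cf cg) /toep /toep_on.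
apply: eq_bigr => a _; apply: eq_bigr => b _.
rewrite /dilate (negbTE ji) !fval_twist !(linZ (lin_iter _ (qlin qT i))) !qcomm_iter //.
rewrite !scalerA (hfZl hC) (hfZr hC) mulrA -[RHS]mul1r; congr (_ * _).
rewrite rmorphM /= Q_conj_expz rmorphXn /= Q_conj.
rewrite (Q_inv i j) !exprnP !exprz_inv -!expfzDr ?Q_neq0 //.
rewrite [X in _ ^ X](_ : _ = (ipos (a - b))%:Z - (ipos (b - a))%:Z - (a - b)); last by ring.
by rewrite ipos_diff subrr expr0z.
Qed.

Lemma toep_sub C' f g :
  toep (fun x y => C x y - C' x y) (T i) f g = toep C (T i) f g - toep C' (T i) f g.
Proof. by rewrite /toep /toep_on -sumrB; apply: eq_bigr => a _; rewrite -sumrB. Qed.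
End Forms.

Lemma defect_dilate w f g : i \notin w ->
  defect (toep B (T i)) dilate w f g = toep (defect B T w) (T i) f g.
Proof.
elim: w f g => [//|j w IH] f g /=; rewrite inE negb_or eq_sym => /andP[ji iw].
have hD := defect_hform w hB (qlin qT).
by rewrite !IH // (toep_dilate hD _ _ ji) toep_sub.
Qed.

(** At the letter [i] a form is subtracted from its own pullback under the shift, which is
    isometric; the letters in front of it then take differences of zeros. *)
Lemma defect_dilate_in w f g : uniq w -> i \in w -> defect (toep B (T i)) dilate w f g = 0.
Proof.
elim: w f g => [//|j w IH] f g /= /andP[jw uw]; rewrite inE.
have [ij _|ij /= iw] := eqVneq i j; last by rewrite !IH // subrr.
rewrite !defect_dilate ?ij // -ij /dilate eqxx toep_shift ?subrr //.
exact: defect_hform hB (qlin qT).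
Qed.

Lemma dilate_brehmer : brehmer (toep B (T i)) dilate.
Proof.
move=> w uw f; rewrite /qf; have [iw|iw] := boolP (i \in w).
  by rewrite defect_dilate_in.
rewrite defect_dilate //; apply: toep_psd => [|||x].
- exact: defect_hform hB (qlin qT).
- exact: (qlin qT).
- exact: bT.
(* Contractivity of [T_i] for the form of [w] is the positivity of the form of [i :: w]. *)
by have := bT (w := i :: w) _ x; rewrite /= iw /qf /= ReB subr_ge0; apply.
Qed.

Lemma delta0_lin : lin delta0.
Proof.
move=> a x y; apply: fval_inj => n; rewrite fvalL !fval_delta0.
by case: eqP; rewrite // scaler0 addr0.
Qed.

(** The twist is trivial at index 0, the only place where [delta0 x] lives. *)
Lemma foldr_delta0 w x : i \notin w -> foldr dilate (delta0 x) w = delta0 (foldr T x w).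
Proof.
elim: w => [//|j w IH] /=; rewrite inE negb_or eq_sym => /andP[ji /IH ->].
apply: fval_inj => n; rewrite /dilate (negbTE ji) fval_twist !fval_delta0.
by case: eqP => [->|_]; rewrite ?expr0z ?scale1r // (lin0 (qlin qT j)) scaler0.
Qed.

Lemma fval_iter_dilate m x n : fval (iter m (dilate i) (delta0 x)) n = if n == m%:Z then x else 0.
Proof.
rewrite /dilate eqxx; elim: m n => [|m IH] n //=.
rewrite fval_shift IH; congr (if _ then _ else _); lia.
Qed.

Lemma toep_iter m x y :
  toep B (T i) (iter m (dilate i) (delta0 x)) (delta0 y) = B (iter m (T i) x) y.
Proof.
rewrite (@toepE _ _ _ _ hB (qlin qT i) [:: m%:Z] [:: 0]).
- rewrite /toep_on !big_seq1 fval_iter_dilate eqxx fval_delta0 eqxx subr0 sub0r.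
  by case: m.
- by split=> // n; rewrite inE fval_iter_dilate => /negbTE ->.
- by split=> // n; rewrite inE fval_delta0 => /negbTE ->.
Qed.

Lemma dilate_words : word_dilation B T (toep B (T i)) dilate delta0.
Proof.
(* The letter [i] is missing from one of the two words, by symmetry the second. In the first it is
   pulled to the front, and the remaining letters act inside [delta0]. *)
have half w1 w2 x y : i \notin w2 ->
    toep B (T i) (foldr dilate (delta0 x) w1) (foldr dilate (delta0 y) w2) =
    B (foldr T x w1) (foldr T y w2).
  move=> iw2; have hT := toep_hform hB (qlin qT i).
  rewrite (foldr_pull w1 i _ dilate_qtuple) (foldr_pull w1 i _ qT) (hfZl hT) (hfZl hB).
  by congr (_ * _); rewrite (foldr_delta0 _ (mem_pull _ _)) (foldr_delta0 _ iw2) toep_iter.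
move=> w1 w2 x y h; have [iw|iw] := boolP (i \in w1); first exact/half/h.
by rewrite (hfC (toep_hform hB (qlin qT i))) half // -(hfC hB).
Qed.

Lemma dilate_isometric j : j = i \/ isometric B (T j) -> isometric (toep B (T i)) (dilate j).
Proof.
move=> h f g; rewrite /dilate; case: eqP => [_|/eqP ji]; first exact: toep_shift.
case: h => [/eqP h|h]; first by rewrite h in ji.
have := toep_dilate hB f g ji; rewrite /dilate (negbTE ji) => ->.
by rewrite /toep /toep_on; apply: eq_bigr => a _; apply: eq_bigr => b _; exact: h.
Qed.

Lemma dilate_bij j : j = i \/ bijective (T j) -> bijective (dilate j).
Proof.
rewrite /dilate; case: eqP => [_ _|/eqP ji [/eqP h|[S TK SK]]].
- by exists unshift => f; apply: fval_inj => n; rewrite ?(fval_shift, fval_unshift) (addrK, subrK).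
- by rewrite h in ji.
have S0 : S 0 = 0 by rewrite -[X in S X](lin0 (qlin qT j)) TK.
(* [S] is given as a bare inverse, without linearity, so the twist is undone before [S] is
   applied. *)
have fin f : fin_supp (fun n => S (Q i j ^ n *: fval f n)).
  by have [r hr] := fvalP f; exists r => n /hr ->; rewrite scaler0 S0.
have fvalS f n : fval (fmk (fin f)) n = S (Q i j ^ n *: fval f n) by [].
exists (fun f => fmk (fin f)) => f; apply: fval_inj => n.
  by rewrite fvalS fval_twist scalerA -expfzMl QC exp1rz scale1r TK.
by rewrite fval_twist fvalS SK scalerA -expfzMl QC exp1rz scale1r.
Qed.
End Step.

Record unitary_on (E : lmodType R[i]) (B : E -> E -> R[i]) (U : E -> E) : Prop := UnitaryOn {
  uo_isometric : isometric B U;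
  uo_bij : bijective U }.

(** The Brehmer condition is part of the conclusion because the next variable is dilated on its
    strength; unitarity is claimed only for the letters already treated. *)
Lemma qtuple_dilation_seq (E : lmodType R[i]) (B : E -> E -> R[i]) (T : I -> E -> E) (l : seq I) :
  hform B -> qtuple T -> brehmer B T ->
  exists (F : lmodType R[i]) (B' : F -> F -> R[i]) (U : I -> F -> F) (V : E -> F),
  [/\ [/\ hform B', qtuple U & brehmer B' U],
      lin V, word_dilation B T B' U V & forall i, i \in l -> unitary_on B' (U i)].
Proof.
move=> hB qT bT; elim: l => [|i l [F [B' [U [V [[hB' qU bU] lV wV uU]]]]]].
  by exists E, B, T, id; split.
exists (fseq F), (toep B' (U i)), (dilate i qU), (@delta0 F \o V).
split.
- split; [exact: toep_hform hB' (qlin qU i)|exact: dilate_qtuple|exact: dilate_brehmer].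
- by move=> a x y /=; rewrite lV delta0_lin.
- by move=> w1 w2 x y h /=; rewrite dilate_words // wV.
move=> j; rewrite inE => jl.
have {}jl : j = i \/ unitary_on B' (U j).
  by case/orP: jl => [/eqP|/uU]; [left|right].
split; [apply: dilate_isometric|apply: dilate_bij] => //;
  by case: jl => [|[]]; [left|right].
Qed.
End QTuples.

(** * Completion *)

Section Limits.
Variable R : realType.
Definition tends (c : nat -> R[i]) l :=
  forall e : R, 0 < e -> exists N : nat, forall n, (N <= n)%N -> normc (c n - l) <= e.

Lemma real_cauchy (x : nat -> R) :
  (forall e : R, 0 < e -> exists N : nat, forall m n, (N <= m)%N -> (N <= n)%N ->
     `|x m - x n| <= e) ->
  exists l : R, forall e : R, 0 < e -> exists N : nat, forall n, (N <= n)%N -> `|x n - l| <= e.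
Proof.
(* [A] collects the eventual lower bounds, so its supremum is the lower limit of [x]. *)
move=> hx; pose A := [set y | exists N : nat, forall n, (N <= n)%N -> y <= x n]%classic.
have ubA e N : (forall m n, (N <= m)%N -> (N <= n)%N -> `|x m - x n| <= e) ->
    ubound A (x N + e).
  move=> hN y [M hM]; have := hM (maxn M N) (leq_maxl _ _).
  have := hN (maxn M N) N (leq_maxr _ _) (leqnn _).
  rewrite ler_norml => /andP[_]; lra.
have inA e N : (forall m n, (N <= m)%N -> (N <= n)%N -> `|x m - x n| <= e) ->
    A (x N - e).
  move=> hN; exists N => n nN.
  by have := hN n N nN (leqnn _); rewrite ler_norml => /andP[+ _]; lra.
have hA : has_sup A.
  have [N hN] := hx 1 ltr01; split; first by exists (x N - 1); exact: inA hN.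
  by exists (x N + 1); exact: ubA hN.
exists (sup A) => e e0; have [N hN] := hx (e / 2) ltac:(lra); exists N => n nN.
have h1 : x N - e / 2 <= sup A by apply: sup_upper_bound => //; exact: inA hN.
have h2 : sup A <= x N + e / 2 by apply: ge_sup; [case: hA|exact: ubA hN].
have := hN n N nN (leqnn _); rewrite !ler_norml; lra.
Qed.

Implicit Types (c : nat -> R[i]) (l : R[i]).

Lemma tends_cauchy c :
  (forall e : R, 0 < e -> exists N : nat, forall m n, (N <= m)%N -> (N <= n)%N ->
     normc (c m - c n) <= e) ->
  exists l, tends c l.
Proof.
move=> hc.
have [|a ha] := @real_cauchy (fun n => Re (c n)).
  move=> e /hc[N hN]; exists N => m n mN nN; apply: le_trans (hN m n mN nN).
  by rewrite -ReB; exact: Re_le_normc.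
have [|b hb] := @real_cauchy (fun n => Im (c n)).
  move=> e /hc[N hN]; exists N => m n mN nN; apply: le_trans (hN m n mN nN).
  by rewrite -ImN -ImD; exact: Im_le_normc.
exists (a +i* b)%C => e e0.
have [N hN] := ha (e / 2) ltac:(lra); have [M hM] := hb (e / 2) ltac:(lra).
exists (maxn N M) => n; rewrite geq_max => /andP[/hN h1 /hM h2].
apply: le_trans (normc_le _) _; rewrite ReB ImD ImN /=; lra.
Qed.

Lemma tends_le c l a (e : R) : tends c l ->
  (exists N : nat, forall n, (N <= n)%N -> normc (c n - a) <= e) -> normc (l - a) <= e.
Proof.
move=> hc [N hN]; apply/ler_addgt0Pr => d /hc[M hM].
have := hM (maxn N M) (leq_maxr _ _); have := hN (maxn N M) (leq_maxl _ _).
have := normcD (l - c (maxn N M)) (c (maxn N M) - a).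
rewrite addrA subrK (normcB l); lra.
Qed.

Lemma tends_unique c l l' : tends c l -> tends c l' -> l = l'.
Proof.
move=> h h'; apply/eqP; rewrite -subr_eq0; apply/eqP/eq0_normc/eqP.
rewrite eq_le normc_ge0 andbT; apply/ler_addgt0Pr => d d0; rewrite add0r.
exact: tends_le h (h' d d0).
Qed.

Lemma tends_const l : tends (fun=> l) l.
Proof. by move=> e e0; exists 0%N => n _; rewrite subrr normc0 ltW. Qed.

Lemma tends_eq c c' l : (forall n, c n = c' n) -> tends c l -> tends c' l.
Proof. by move=> h; have -> : c' = c by apply/funext. Qed.

Lemma tendsL a c c' l l' : tends c l -> tends c' l' ->
  tends (fun n => a * c n + c' n) (a * l + l').
Proof.
move=> h h' e e0; have a0 := normc_ge0 a.
have [N hN] := h (e / 2 / (normc a + 1)) ltac:(by rewrite !divr_gt0 //; lra).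
have [M hM] := h' (e / 2) ltac:(lra).
exists (maxn N M) => n; rewrite geq_max => /andP[/hN h1 /hM h2].
have -> : a * c n + c' n - (a * l + l') = a * (c n - l) + (c' n - l') by ring.
apply: le_trans (normcD _ _) _; rewrite normcM.
suff : normc a * normc (c n - l) <= e / 2 by lra.
apply: (@le_trans _ _ ((normc a + 1) * normc (c n - l))).
  by rewrite ler_wpM2r ?normc_ge0 //; lra.
by rewrite mulrC -ler_pdivlMr //; lra.
Qed.

Lemma tends_conj c l : tends c l -> tends (fun n => (c n)^*) (l^*).
Proof.
move=> h e /h[N hN]; exists N => n /hN; by rewrite -rmorphB normc_conj.
Qed.
End Limits.

Section Completion.
Variables (R : realType) (E : lmodType R[i]) (B : E -> E -> R[i]).
Hypotheses (hB : hform B) (pB : psd B).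
Local Notation nB := (nf B).

Definition approx (phi : E -> R[i]^o) (x : E) (d : R) :=
  forall z, normc (phi z - B x z) <= d * nB z.

(* Elements of the completion are realised as the limits, in the dual norm,
   of the conjugate-linear functionals B x; equality of functionals then takes
   care of the quotient by the null vectors of B. *)
Definition approximable (phi : E -> R[i]^o) :=
  (forall a z, phi (a *: z) = a^* * phi z) /\ forall e : R, 0 < e -> exists x, approx phi x e.

Lemma approxL a phi psi x y d e : approx phi x d -> approx psi y e ->
  approx (a *: phi + psi) (a *: x + y) (normc a * d + e).
Proof.
move=> hx hy z; have -> : (a *: phi + psi) z = a * phi z + psi z by [].
rewrite (hfl hB).
have -> : a * phi z + psi z - (a * B x z + B y z) = a * (phi z - B x z) + (psi z - B y z).
  by rewrite mulrBr opprD !addrA; congr (_ + _); rewrite addrAC.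
apply: le_trans (normcD _ _) _; rewrite normcM mulrDl -mulrA lerD // ler_wpM2l //.
exact: normc_ge0.
Qed.

Lemma approx_le phi x d e : d <= e -> approx phi x d -> approx phi x e.
Proof. by move=> de h z; apply: le_trans (h z) _; rewrite ler_wpM2r ?nf_ge0. Qed.

Lemma approximable0 : approximable 0.
Proof.
split=> [a z|e e0]; first by rewrite mulr0.
by exists 0 => z; rewrite (hf0l hB) subr0 normc0 mulr_ge0 ?nf_ge0 // ltW.
Qed.

Lemma approximableL a phi psi :
  approximable phi -> approximable psi -> approximable (a *: phi + psi).
Proof.
move=> [h1 a1] [h2 a2]; split=> [c z|e e0].
  have eq z' : (a *: phi + psi) z' = a * phi z' + psi z' by [].
  by rewrite !eq h1 h2; rewrite mulrDr !mulrA [a * _]mulrC.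
have a0 := normc_ge0 a.
have [x hx] := a1 (e / 2 / (normc a + 1)) ltac:(by rewrite !divr_gt0 //; lra).
have [y hy] := a2 (e / 2) ltac:(lra).
exists (a *: x + y); apply: approx_le (approxL a hx hy).
suff : normc a * (e / 2 / (normc a + 1)) <= e / 2 by lra.
rewrite mulrCA ler_piMr //; first lra.
by rewrite ler_pdivrMr ?mul1r; lra.
Qed.

Definition cfunctional := sm_type (Submodule approximable0 approximableL).
Definition ev (phi : cfunctional) : E -> R[i]^o := sm_val phi.
Definition dmk phi (h : approximable phi) : cfunctional :=
  sm_mk (S := Submodule approximable0 approximableL) h.

Lemma evP phi : approximable (ev phi). Proof. exact: (sm_valP phi). Qed.
Lemma evL a (phi psi : cfunctional) z : ev (a *: phi + psi) z = a * ev phi z + ev psi z.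
Proof. by rewrite /ev sm_valL. Qed.
Lemma ev_inj (phi psi : cfunctional) : (forall z, ev phi z = ev psi z) -> phi = psi.
Proof. by move=> h; apply: sm_val_inj; apply/funext. Qed.

Lemma evZ a (phi : cfunctional) z : ev (a *: phi) z = a * ev phi z.
Proof.
have h0 : ev 0 z = 0 by have := evL (-1) 0 0 z; rewrite scaler0 addr0 mulN1r addNr.
by rewrite -[a *: phi]addr0 evL h0 addr0.
Qed.

Definition converges (u : nat -> E) (phi : E -> R[i]^o) :=
  forall e : R, 0 < e -> exists N : nat, forall n, (N <= n)%N -> approx phi (u n) e.

Lemma converges_ex phi : approximable phi -> exists u, converges u phi.
Proof.
move=> [_ h].
have g n : 0 < n.+1%:R^-1 :> R by rewrite invr_gt0 ltr0Sn.
have [u hu] := choice (fun n => h _ (g n)).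
exists u => e e0.
exists (Num.bound e^-1) => n nN.
apply: approx_le (hu n); rewrite invf_ple ?posrE ?ltr0Sn //.
have := archi_boundP (ltW (_ : 0 < e^-1)); rewrite invr_gt0 => /(_ e0) /ltW h1.
by apply: le_trans h1 _; rewrite ler_nat; exact: leq_trans nN _.
Qed.

Lemma convergesL a phi psi u v : converges u phi -> converges v psi ->
  converges (fun n => a *: u n + v n) (a *: phi + psi).
Proof.
move=> hu hv e e0; have a0 := normc_ge0 a.
have [N hN] := hu (e / 2 / (normc a + 1)) ltac:(by rewrite !divr_gt0 //; lra).
have [M hM] := hv (e / 2) ltac:(lra).
exists (maxn N M) => n; rewrite geq_max => /andP[/hN h1 /hM h2].
apply: approx_le (approxL a h1 h2).
suff : normc a * (e / 2 / (normc a + 1)) <= e / 2 by lra.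
rewrite mulrCA ler_piMr //; first lra.
by rewrite ler_pdivrMr ?mul1r; lra.
Qed.

Lemma nf_le_of_sq w c : 0 <= c -> qf B w <= c * nB w -> nB w <= c.
Proof.
move=> c0; rewrite -(nf_sq pB); have := nf_ge0 B w; rewrite le_eqVlt => /orP[/eqP <- //|n0].
by rewrite expr2 ler_pM2r.
Qed.

(** Both approximations are tested at the vector [x - y] itself, which gives
    [nB w ^+ 2 <= 2 * d * nB w]. *)
Lemma approx_dist phi x y d : 0 <= d -> approx phi x d -> approx phi y d -> nB (x - y) <= 2 * d.
Proof.
move=> d0 hx hy; set w := x - y; apply: nf_le_of_sq; first lra.
apply: le_trans (ler_norm _) _; apply: le_trans (Re_le_normc _) _.
have -> : B w w = (B x w - phi w) + (phi w - B y w) by rewrite addrA subrK -(hfBl hB).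
by have := normcD (B x w - phi w) (phi w - B y w); rewrite (normcB (B x w));
  have := hx w; have := hy w; lra.
Qed.

Lemma approx_bounded phi : approximable phi ->
  exists2 M : R, 0 < M & forall x, approx phi x 1 -> nB x <= M.
Proof.
move=> [_ /(_ 1 ltr01)[x hx]]; exists (nB x + 2) => [|y hy].
  by have := nf_ge0 B x; lra.
have := approx_dist ler01 hy hx; have := nfD hB pB (y - x) x; rewrite subrK; lra.
Qed.

Lemma form_uniform phi psi : approximable phi -> approximable psi ->
  forall e : R, 0 < e -> exists2 d : R, 0 < d & forall x x' y y',
    approx phi x d -> approx phi x' d -> approx psi y d -> approx psi y' d ->
    normc (B x y - B x' y') <= e.
Proof.
move=> /approx_bounded[M M0 hM] /approx_bounded[L L0 hL] e e0.
(* The bound 1 keeps all approximants within the radii [M] and [L]; two approximants differ by at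
   most [2 * d], so the form varies by at most [2 * d * L + M * (2 * d)]. *)
pose d := Num.min 1 (e / (2 * (M + L))).
have d0 : 0 < d by rewrite lt_min ltr01 divr_gt0 //; lra.
have d1 : d <= 1 by rewrite ge_min lexx.
have de : d * (2 * (M + L)) <= e by rewrite -ler_pdivlMr ?ge_min ?lexx ?orbT //; lra.
exists d => // x x' y y' hx hx' hy hy'.
have -> : B x y - B x' y' = B (x - x') y + B x' (y - y').
  by rewrite (hfBl hB) (hfBr hB) addrA subrK.
apply: le_trans (normcD _ _) _; apply: le_trans de.
have h1 := cauchy_schwarz hB pB (x - x') y; have h2 := cauchy_schwarz hB pB x' (y - y').
have h3 := approx_dist (ltW d0) hx hx'; have h4 := approx_dist (ltW d0) hy hy'.
have h5 := hM _ (approx_le d1 hx'); have h6 := hL _ (approx_le d1 hy).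
have n1 := nf_ge0 B (x - x'); have n2 := nf_ge0 B y; have n3 := nf_ge0 B x'.
have n4 := nf_ge0 B (y - y').
have := ler_pM n1 n2 h3 h6; have := ler_pM n3 n4 h5 h4; lra.
Qed.

(** One limit serves all approximating sequences, so [dot] can later be computed along any
    convenient pair. *)
Lemma dot_ex phi psi : approximable phi -> approximable psi ->
  exists l, forall u v, converges u phi -> converges v psi -> tends (fun n => B (u n) (v n)) l.
Proof.
move=> hp hq; have [u hu] := converges_ex hp; have [v hv] := converges_ex hq.
have [l hl] : exists l, tends (fun n => B (u n) (v n)) l.
  apply: tends_cauchy => e /(form_uniform hp hq)[d d0 hd].
  have [N hN] := hu d d0; have [M hM] := hv d d0.
  by exists (maxn N M) => m n; rewrite !geq_max => /andP[? ?] /andP[? ?]; apply: hd; auto.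
exists l => u' v' hu' hv' e e0.
have [d d0 hd] := form_uniform hp hq (e := e / 2) ltac:(lra).
have [N1 h1] := hu d d0; have [N2 h2] := hv d d0.
have [N3 h3] := hu' d d0; have [N4 h4] := hv' d d0; have [N5 h5] := hl (e / 2) ltac:(lra).
exists (maxn (maxn N1 N2) (maxn (maxn N3 N4) N5)) => n.
rewrite !geq_max => /andP[/andP[k1 k2] /andP[/andP[k3 k4] k5]].
have := hd _ _ _ _ (h3 _ k3) (h1 _ k1) (h4 _ k4) (h2 _ k2); have := h5 _ k5.
have := normcD (B (u' n) (v' n) - B (u n) (v n)) (B (u n) (v n) - l).
rewrite addrA subrK; lra.
Qed.

Definition dot (phi psi : cfunctional) : R[i] := projT1 (cid (dot_ex (evP phi) (evP psi))).

Lemma dotP phi psi u v : converges u (ev phi) -> converges v (ev psi) ->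
  tends (fun n => B (u n) (v n)) (dot phi psi).
Proof. by rewrite /dot; case: (cid _) => l /= h; exact: h. Qed.

Lemma dot_hform : hform dot.
Proof.
split=> [a x y z|x y].
  have [u hu] := converges_ex (evP x); have [v hv] := converges_ex (evP y).
  have [w hw] := converges_ex (evP z).
  apply: tends_unique (tendsL a (dotP hu hw) (dotP hv hw)).
  have hc : converges (fun n => a *: u n + v n) (ev (a *: x + y)).
    by rewrite /ev sm_valL; exact: convergesL.
  by apply: tends_eq (dotP hc hw) => n; rewrite (hfl hB).
have [u hu] := converges_ex (evP x); have [v hv] := converges_ex (evP y).
apply: tends_unique (dotP hv hu) _; apply: tends_eq (tends_conj (dotP hu hv)) => n.
by rewrite -(hfC hB).
Qed.

Lemma dot_psd : psd dot.
Proof.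
move=> x; have [u hu] := converges_ex (evP x).
apply/ler_addgt0Pr => e e0; have [N hN] := dotP hu hu e0.
have := le_trans (ler_norm _) (le_trans (Re_le_normc _) (hN N (leqnn N))).
by have := pB (u N); rewrite /qf ReB; lra.
Qed.

Lemma approximable_form x : approximable (fun z => B x z : R[i]^o).
Proof.
split=> [a z|e e0]; first exact: hfZr.
by exists x => z; rewrite subrr normc0 mulr_ge0 ?nf_ge0 // ltW.
Qed.

Definition embed x : cfunctional := dmk (approximable_form x).

Lemma ev_embed x z : ev (embed x) z = B x z. Proof. by []. Qed.

Lemma embed_lin : lin embed.
Proof. by move=> a x y; apply: ev_inj => z; rewrite evL !ev_embed (hfl hB). Qed.

Lemma converges_embed x : converges (fun=> x) (ev (embed x)).
Proof.
by move=> e e0; exists 0%N => n _ z; rewrite subrr normc0 mulr_ge0 ?nf_ge0 // ltW.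
Qed.

Lemma dot_embed x y : dot (embed x) (embed y) = B x y.
Proof.
exact: tends_unique (dotP (converges_embed x) (converges_embed y)) (tends_const _).
Qed.

Lemma dot_ev phi z : dot phi (embed z) = ev phi z.
Proof.
have [u hu] := converges_ex (evP phi).
apply: tends_unique (dotP hu (converges_embed z)) _ => e e0.
have n0 := nf_ge0 B z.
have [N hN] := hu (e / (nB z + 1)) ltac:(by rewrite divr_gt0 //; lra).
exists N => n /hN /(_ z) h; rewrite normcB; apply: le_trans h _.
by rewrite mulrAC ler_pdivrMr; [rewrite ler_pM2l|]; lra.
Qed.

Lemma ev_le phi z : normc (ev phi z) <= nf dot phi * nB z.
Proof.
rewrite -dot_ev; apply: le_trans (cauchy_schwarz dot_hform dot_psd _ _) _.
by rewrite {2}/nf /qf dot_embed.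
Qed.

(** Together with [ev_le] this identifies the norm of [dot] with the dual norm. The approximants of
    [phi] nearly satisfy [nB u ^+ 2 <= e * nB u], and their norms tend to that of [phi]. *)
Lemma nf_dot_le phi e : 0 <= e -> (forall z, normc (ev phi z) <= e * nB z) -> nf dot phi <= e.
Proof.
move=> e0 h; have [u hu] := converges_ex (evP phi).
have step d : 0 < d -> qf dot phi <= (e + d) ^+ 2 + d.
  move=> d0; have [N hN] := hu d d0; have [M hM] := dotP hu hu d0.
  set n := maxn N M; have := hM n (leq_maxr _ _); have := hN n (leq_maxl _ _).
  move=> /(_ (u n)) h1 h2.
  have h3 : nB (u n) <= e + d.
    apply: nf_le_of_sq; first lra.
    apply: le_trans (ler_norm _) _; apply: le_trans (Re_le_normc _) _.
    have := normcD (B (u n) (u n) - ev phi (u n)) (ev phi (u n)).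
    by rewrite subrK normcB; have := h (u n); lra.
  have n0 := nf_ge0 B (u n).
  have h4 : qf B (u n) <= (e + d) ^+ 2.
    by rewrite -(nf_sq pB) ler_pXn2r ?nnegrE //; lra.
  have := le_trans (ler_norm _) (le_trans (Re_le_normc _) h2).
  have := Re_le_normc (B (u n) (u n) - dot phi phi); rewrite ler_norml => /andP[+ _].
  by rewrite ReB /qf in h4 *; rewrite /qf in h4; lra.
rewrite -(@ler_pXn2r _ 2) ?nnegrE ?nf_ge0 // (nf_sq dot_psd).
(* With [d <= 1] one has [(e + d) ^+ 2 + d <= e ^+ 2 + (2 * e + 2) * d], and the last term is at
   most [c]. *)
apply/ler_addgt0Pr => c c0; pose d := Num.min 1 (c / (2 * e + 2)).
have d0 : 0 < d by rewrite lt_min ltr01 divr_gt0 //; lra.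
have d1 : d <= 1 by rewrite ge_min lexx.
have dc : d * (2 * e + 2) <= c by rewrite -ler_pdivlMr ?ge_min ?lexx ?orbT //; lra.
apply: le_trans (step d d0) _.
have : d ^+ 2 <= d by rewrite expr2 ler_piMr // ltW.
by move: dc; rewrite sqrrD; lra.
Qed.

Lemma dot_eq0 phi : dot phi phi = 0 -> phi = 0.
Proof.
move=> h; apply: ev_inj => z.
have -> : ev 0 z = 0.
  by have := evL (-1) 0 0 z; rewrite scaler0 addr0 mulN1r addNr.
apply: eq0_normc; apply/eqP; rewrite eq_le normc_ge0 andbT.
by apply: le_trans (ev_le _ _) _; rewrite /nf /qf h sqrtr0 mul0r.
Qed.

Lemma evB phi psi z : ev (phi - psi) z = ev phi z - ev psi z.
Proof.
have := evL (-1) psi phi z; rewrite scaleN1r mulN1r addrC => ->; exact: addrC.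
Qed.

(** The limit is taken pointwise on functionals. [ev_le] makes the convergence uniform relative to
    [nB], hence the limit approximable, and [nf_dot_le] translates back into the norm of [dot]. *)
Lemma dot_complete (u : nat -> cfunctional) :
  (forall e : R, 0 < e -> exists N : nat, forall m n : nat, (N <= m)%N -> (N <= n)%N ->
     nf dot (u m - u n) < e) ->
  exists l, forall e : R, 0 < e -> exists N : nat, forall n : nat, (N <= n)%N ->
     nf dot (u n - l) < e.
Proof.
move=> hu.
have cz z : exists l, tends (fun n => ev (u n) z) l.
  apply: tends_cauchy => e e0; have n0 := nf_ge0 B z.
  have [N hN] := hu (e / (nB z + 1)) ltac:(by rewrite divr_gt0 //; lra).
  exists N => m n mN nN; rewrite -evB; apply: le_trans (ev_le _ _) _.
  apply: (@le_trans _ _ (e / (nB z + 1) * nB z)).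
    by rewrite ler_wpM2r // ltW // hN.
  by rewrite mulrAC ler_pdivrMr; [rewrite ler_pM2l|]; lra.
pose chi z : R[i]^o := projT1 (cid (cz z)).
have chiP z : tends (fun n => ev (u n) z) (chi z) by rewrite /chi; case: (cid _).
have close e : 0 < e -> exists N : nat, forall n, (N <= n)%N ->
    forall z, normc (ev (u n) z - chi z) <= e * nB z.
  move=> /hu[N hN]; exists N => n nN z; rewrite normcB.
  apply: tends_le (chiP z) _; exists N => m mN; rewrite -evB.
  apply: le_trans (ev_le _ _) _; rewrite ler_wpM2r ?nf_ge0 // ltW //; exact: hN.
have happ : approximable chi.
  split=> [a z|e e0].
    apply: tends_unique (chiP _) _.
    have := tendsL (a^*) (chiP z) (tends_const 0); rewrite addr0.
    by apply: tends_eq => n; rewrite addr0 (proj1 (evP (u n))).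
  have [N hN] := close (e / 2) ltac:(lra).
  have [_ /(_ (e / 2) ltac:(lra))[x hx]] := evP (u N).
  exists x => z.
  have -> : chi z - B x z = (chi z - ev (u N) z) + (ev (u N) z - B x z).
    by rewrite addrA subrK.
  apply: le_trans (normcD _ _) _; rewrite (normcB (chi z)).
  apply: le_trans (lerD (hN N (leqnn N) z) (hx z)) _; lra.
exists (dmk happ) => e e0; have [N hN] := close (e / 2) ltac:(lra).
exists N => n nN; apply: (@le_lt_trans _ _ (e / 2)); last lra.
apply: nf_dot_le; first lra.
by move=> z; rewrite evB; exact: hN.
Qed.

Lemma dot_ge0 phi : 0 <= dot phi phi.
Proof. by rewrite (hf_self dot_hform) ler0c; exact: dot_psd. Qed.

Definition completion : hilbert R :=
  @Hilbert R cfunctional dot (hfl dot_hform) (hfC dot_hform) dot_ge0 dot_eq0 dot_complete.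

(** * Extension of unitaries to the completion *)

Section Lift.
Variables (U Ui : E -> E).
Hypotheses (lU : lin U) (iU : isometric B U) (UK : cancel U Ui) (UiK : cancel Ui U).

Lemma inverse_lin : lin Ui.
Proof. by move=> a x y; rewrite -{1}(UiK x) -{1}(UiK y) -lU UK. Qed.
Lemma inverse_isometric : isometric B Ui.
Proof. by move=> x y; rewrite -iU !UiK. Qed.

Lemma approx_lift phi x d : approx phi x d -> approx (fun z => phi (Ui z)) (U x) d.
Proof.
move=> h z; have -> : B (U x) z = B x (Ui z) by rewrite -(inverse_isometric (U x)) UK.
have -> : nB z = nB (Ui z) by rewrite /nf /qf inverse_isometric.
exact: h.
Qed.

Lemma approximable_lift phi : approximable phi -> approximable (fun z => phi (Ui z)).
Proof.
move=> [h1 h2]; split=> [a z|e /h2[x hx]]; first by rewrite (linZ inverse_lin) h1.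
by exists (U x); exact: approx_lift.
Qed.

(** [U] should send the functional of [x] to that of [U x], and [B (U x) z = B x (Ui z)]: hence
    precomposition with the inverse, which makes sense for every functional. *)
Definition op_lift (phi : cfunctional) : cfunctional := dmk (approximable_lift (evP phi)).

Lemma ev_lift phi z : ev (op_lift phi) z = ev phi (Ui z). Proof. by []. Qed.

Lemma op_lift_lin : lin op_lift.
Proof. by move=> a x y; apply: ev_inj => z; rewrite ev_lift !evL !ev_lift. Qed.

Lemma converges_lift u phi : converges u (ev phi) -> converges (U \o u) (ev (op_lift phi)).
Proof.
by move=> h e /h[N hN]; exists N => n /hN; exact: approx_lift.
Qed.

Lemma dot_lift phi psi : dot (op_lift phi) (op_lift psi) = dot phi psi.
Proof.
have [u hu] := converges_ex (evP phi); have [v hv] := converges_ex (evP psi).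
apply: tends_unique (dotP (converges_lift hu) (converges_lift hv)) _.
by apply: tends_eq (dotP hu hv) => n; rewrite /= iU.
Qed.

Lemma op_lift_embed x : op_lift (embed x) = embed (U x).
Proof.
apply: ev_inj => z; rewrite ev_lift !ev_embed -(inverse_isometric (U x)) UK //.
Qed.
End Lift.
End Completion.

Lemma bijective_inverse (X : Type) (f : X -> X) : bijective f ->
  exists g, cancel f g /\ cancel g f.
Proof. by case=> g h1 h2; exists g. Qed.

Lemma completion_exists (R : realType) (E : lmodType R[i]) (B : E -> E -> R[i])
   (I : eqType) (Q : I -> I -> R[i]) (U : I -> E -> E) :
  (forall i j, Q i j * (Q i j)^* = 1) ->
  hform B -> psd B -> qtuple Q U -> (forall i, unitary_on B (U i)) ->
  exists (K : hilbert R) (J : E -> K) (W Wi : I -> K -> K),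
  [/\ lin J, forall x y, hdot (J x) (J y) = B x y,
      forall i x, W i (J x) = J (U i x), qtuple Q W &
      forall i, [/\ isometric (@hdot R K) (W i), cancel (W i) (Wi i) & cancel (Wi i) (W i)]].
Proof.
move=> Qu hB pB qU uU.
have [Ui hUi] := choice (fun i => bijective_inverse (uo_bij (uU i))).
have UK i := (hUi i).1; have UiK i := (hUi i).2.
have iU i := uo_isometric (uU i); have lU i := qlin qU i.
have lUi i := inverse_lin (lU i) (UK i) (UiK i).
have iUi i := inverse_isometric (iU i) (UiK i).
pose W i := @op_lift R E B hB (U i) (Ui i) (lU i) (iU i) (UK i) (UiK i).
pose Wi i := @op_lift R E B hB (Ui i) (U i) (lUi i) (iUi i) (UiK i) (UK i).
exists (completion hB pB), (embed hB), W, Wi; split.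
- exact: embed_lin.
- exact: dot_embed.
- by move=> i x; exact: op_lift_embed.
- split=> [i|i j phi]; first exact: op_lift_lin.
  (* Precomposition reverses the order of the inverses; the conjugate scalar obtained here becomes
     [Q i j] again because functionals are conjugate-homogeneous. *)
  have comm z : Ui j (Ui i z) = (Q i j)^* *: Ui i (Ui j z).
    have -> : Ui i (Ui j z) = Q i j *: Ui j (Ui i z).
      apply: (can_inj (UK i)); apply: (can_inj (UK j)).
      by rewrite (linZ (lU _)) (linZ (lU _)) -(qcomm qU i j) !UiK.
    by rewrite scalerA mulrC Qu scale1r.
  apply: ev_inj => z; rewrite evZ !ev_lift comm (proj1 (evP phi)) conjCK //.
move=> i; split.
- by move=> x y; exact: dot_lift.
- by move=> phi; apply: ev_inj => z; rewrite !ev_lift UK.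
- by move=> phi; apply: ev_inj => z; rewrite !ev_lift UiK.
Qed.

(** * Positivity of the Brehmer forms *)

Section BrehmerPositivity.
Variables (R : realType) (I : finType) (E : lmodType R[i]) (B : E -> E -> R[i]) (T : I -> E -> E).
Hypotheses (hB : hform B) (pB : psd B) (lT : forall i, lin (T i)).

Lemma qf_defect_cons i w x :
  qf (defect B T (i :: w)) x = qf (defect B T w) x - qf (defect B T w) (T i x).
Proof. by rewrite /qf /= ReB. Qed.

Lemma brehmer_isometric : (forall i x, qf B (T i x) = qf B x) -> brehmer B T.
Proof.
move=> iT [|i w] _; first exact: pB.
(* For isometries the alternating sum cancels for every nonempty word. *)
suff h j w' x : qf (defect B T (j :: w')) x = 0 by move=> x; rewrite h.
elim: w' j x => [|l w' IH] j x; first by rewrite qf_defect_cons /= iT subrr.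
by rewrite qf_defect_cons !IH subrr.
Qed.

Lemma brehmer_sum_le1 (c : I -> R) : (forall i, 0 <= c i) -> \sum_i c i <= 1 ->
  (forall i x, qf B (T i x) <= c i * qf B x) -> brehmer B T.
Proof.
move=> c0 c1 hc w uw x.
(* The lower bound is not inductive alone: the subtracted form at [T i y] must be at most
   [qf B (T i y)], hence at most [c i * qf B y]. The upper bound in turn uses that this form is
   nonnegative there. *)
have bounds w' : \sum_(i <- w') c i <= 1 -> forall y,
    (1 - \sum_(i <- w') c i) * qf B y <= qf (defect B T w') y <= qf B y.
  elim: w' => [_ y|i w' IH]; first by rewrite big_nil subr0 mul1r lexx.
  rewrite big_cons => s1 y; have ci := c0 i.
  have /IH {}IH : \sum_(j <- w') c j <= 1 by lra.
  have /andP[l1 u1] := IH y; have /andP[l2 u2] := IH (T i y); have h := hc i y.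
  have p := pB (T i y); rewrite qf_defect_cons mulrBl in l1 *.
  have l0 : 0 <= (1 - \sum_(j <- w') c j) * qf B (T i y) by rewrite mulr_ge0 //; lra.
  rewrite mulrBl mulrDl; lra.
have sw : \sum_(i <- w) c i <= 1.
  apply: le_trans c1; rewrite big_uniq //= [leRHS](bigID (mem w)) /= lerDl.
  by apply: sumr_ge0.
by have /andP[l _] := bounds w sw x; apply: le_trans l; rewrite mulr_ge0 // subr_ge0.
Qed.

(** By convexity a positive first increment persists, and the sequence would grow at least
    linearly. *)
Lemma convex_bounded_le (r : nat -> R) (M : R) :
  (forall n, 2 * r n.+1 <= r n + r n.+2) -> (forall n, r n <= M) -> r 1%N <= r 0%N.
Proof.
move=> cv bd; rewrite leNgt; apply/negP => h; set d := r 1%N - r 0%N.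
have d0 : 0 < d by rewrite subr_gt0.
have incr n : d <= r n.+1 - r n.
  by elim: n => [|n IH]; [rewrite lexx|have := cv n; lra].
have lin_le n : n%:R * d <= r n - r 0%N.
  elim: n => [|n IH]; first by rewrite mul0r subrr.
  by rewrite -natr1 mulrDl mul1r; have := incr n; lra.
pose N := Num.bound ((M - r 0%N) / d).
have : (M - r 0%N) / d < N%:R.
  by apply: archi_boundP; rewrite divr_ge0 ?(ltW d0) // subr_ge0.
rewrite ltr_pdivrMr //; have := lin_le N; have := bd N; lra.
Qed.

Section DoublyCommuting.
Variables (Q : I -> I -> R[i]) (S : I -> E -> E).
Hypotheses (qT : forall i j x, i != j -> T i (T j x) = Q i j *: T j (T i x))
  (qS : forall i j x, i != j -> T i (S j x) = (Q i j)^* *: S j (T i x))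
  (adj : forall i x y, B (T i x) y = B x (S i y))
  (cT : forall i x, nf B (T i x) <= nf B x).

Lemma adjoint_contraction i x : nf B (S i x) <= nf B x.
Proof.
have := nf_ge0 B (S i x); rewrite le_eqVlt => /orP[/eqP <-|n0]; first exact: nf_ge0.
rewrite -(ler_pM2l n0) -expr2 (nf_sq pB) /qf -adj.
apply: le_trans (ler_norm _) _; apply: le_trans (Re_le_normc _) _.
apply: le_trans (cauchy_schwarz hB pB _ _) _.
by rewrite ler_wpM2r ?nf_ge0.
Qed.

(** [S_i] stays adjoint to [T_i] for the Brehmer forms: passing [T_j] costs [Q j i] on the left and
    its conjugate on the right, and the form conjugates the latter back. *)
Lemma defect_adjoint i w x y : i \notin w ->
  defect B T w (T i x) y = defect B T w x (S i y).
Proof.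
elim: w x y => [|j w IH] x y /=; first by rewrite adj.
rewrite inE negb_or => /andP[ij iw]; have hD := defect_hform w hB lT.
rewrite IH // qT 1?eq_sym // qS 1?eq_sym // (hfZl hD) (hfZr hD) conjCK IH //.
Qed.

Lemma defect_bounded w : exists2 M : R, 0 <= M & forall x y,
  normc (defect B T w x y) <= M * (nf B x * nf B y).
Proof.
elim: w => [|j w [M M0 IH]].
  by exists 1 => // x y; rewrite mul1r; exact: cauchy_schwarz.
exists (2 * M) => [|x y /=]; first lra.
apply: le_trans (normcD _ _) _; rewrite normcN.
have h : M * (nf B (T j x) * nf B (T j y)) <= M * (nf B x * nf B y).
  by rewrite ler_wpM2l // ler_pM ?nf_ge0.
have := IH x y; have := IH (T j x) (T j y); lra.
Qed.

(* With A := S_i T_i, symmetric for the form D, the norms r_n := |A^n x|_D satisfy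
   r_(n+1)^2 <= r_n r_(n+2) and stay bounded; a bounded convex sequence cannot
   increase, hence |T_i x|_D^2 = D x (A x) <= r_0 r_1 <= r_0^2. *)
Lemma defect_contraction i w x : i \notin w -> psd (defect B T w) ->
  qf (defect B T w) (T i x) <= qf (defect B T w) x.
Proof.
move=> iw; set D := defect B T w => pD; have hD : hform D := defect_hform w hB lT.
pose A y := S i (T i y).
have symA y z : D (A y) z = D y (A z).
  by rewrite (hfC hD z) /A /D -!(defect_adjoint _ _ iw) -(hfC hD).
pose r n := nf D (iter n A x).
have cvx n : 2 * r n.+1 <= r n + r n.+2.
  have r0 := nf_ge0 D (iter n A x); have r2 := nf_ge0 D (iter n.+2 A x).
  have : r n.+1 ^+ 2 <= r n * r n.+2.
    have -> : r n.+1 = nf D (A (iter n A x)) by [].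
    rewrite (nf_sq pD) /qf symA.
    by apply: le_trans (ler_norm _) _; apply: le_trans (Re_le_normc _) _; exact: cauchy_schwarz.
  rewrite -/(r n) -/(r n.+2) in r0 r2 *; move=> h.
  rewrite -(@ler_pXn2r _ 2) ?nnegrE ?mulr_ge0 ?addr_ge0 ?nf_ge0 // exprMn.
  by have := sqr_ge0 (r n - r n.+2); rewrite sqrrB sqrrD; lra.
have [M M0 hM] := defect_bounded w.
have bd n : r n <= Num.sqrt (M * (nf B x * nf B x)).
  have le n' : nf B (iter n' A x) <= nf B x.
    elim: n' => [|n' IH] //=; apply: le_trans IH.
    by apply: le_trans (adjoint_contraction _ _) _.
  rewrite /r /nf ler_wsqrtr // -/(nf B x).
  apply: le_trans (ler_norm _) _; apply: le_trans (Re_le_normc _) _.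
  by apply: le_trans (hM _ _) _; rewrite ler_wpM2l // ler_pM ?nf_ge0.
have r1 := convex_bounded_le cvx bd.
rewrite {1}/qf {1}/D defect_adjoint // -/D -(nf_sq pD).
apply: le_trans (ler_norm _) _; apply: le_trans (Re_le_normc _) _.
apply: le_trans (cauchy_schwarz hD pD _ _) _.
by rewrite expr2 ler_wpM2l ?nf_ge0.
Qed.

Lemma brehmer_doubly : brehmer B T.
Proof.
elim=> [_|i w IH /= /andP[iw /IH pD] x]; first exact: pB.
by rewrite qf_defect_cons subr_ge0 defect_contraction.
Qed.
End DoublyCommuting.
End BrehmerPositivity.

(** * Regular dilations *)

Section HilbertSpaces.
Variables (R : realType) (H : hilbert R).

Lemma hdot_hform : hform (@hdot R H).
Proof. by split; [exact: hdotDl|exact: hdotC]. Qed.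

Lemma hdot_psd : psd (@hdot R H).
Proof. by move=> x; have := hdot_ge0 x; rewrite lecE => /andP[]. Qed.

Lemma hnormE x : hnorm x = nf (@hdot R H) x. Proof. by []. Qed.

Lemma opnorm_le (T : H -> H) x : hcontraction T -> hnorm (T x) <= opnorm T * hnorm x.
Proof.
move=> [lT cT]; have hB := hdot_hform; have pB := hdot_psd.
have [x0|nx0] := eqVneq (hnorm x) 0.
  by rewrite x0 mulr0 -x0.
have xp : 0 < hnorm x by rewrite lt_def nx0 sqrtr_ge0.
have nZ (a : R) (y : H) : 0 <= a -> hnorm (a%:C%C *: y) = a * hnorm y.
  move=> a0; by rewrite !hnormE (nfZ hB) /= expr0n addr0 sqrtr_sqr ger0_norm.
rewrite -ler_pdivrMr // mulrC -nZ ?invr_ge0 ?(ltW xp) // -(linZ lT).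
rewrite /opnorm; set A := (X in sup X).
(* Contractivity bounds the set, so [sup] is a true supremum and not a default value. *)
have hA : has_sup A.
  split; first by exists (hnorm (T 0)), 0 => //=; rewrite /hnorm (hf0l hB) /= sqrtr0 ler01.
  by exists 1 => _ [y /= y1 <-]; exact: le_trans (cT y) y1.
apply: (sup_upper_bound hA).
by exists ((hnorm x)^-1%:C%C *: x) => //=; rewrite nZ ?invr_ge0 ?(ltW xp) // mulVf.
Qed.

Lemma foldr_adjoint (I : Type) (S A : I -> H -> H) w y z :
  (forall i x x', hdot (S i x) x' = hdot x (A i x')) ->
  hdot (foldr S y w) z = hdot y (foldr A z (rev w)).
Proof.
move=> h; elim: w z => [//|i w IH] z; by rewrite rev_cons foldr_rcons /= h IH.
Qed.
End HilbertSpaces.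

Lemma opprod_iter (I X : Type) (J : Type) (T : I -> X -> X) (n : J -> nat) (alpha : J -> I) s x :
  opprod [seq iter (n j) (T (alpha j)) | j <- s] x =
  foldr T x (flatten [seq nseq (n j) (alpha j) | j <- s]).
Proof.
elim: s => [//|j s IH] /=; rewrite -/(opprod _) IH foldr_cat.
by elim: (n j) => [//|m /= ->].
Qed.

Lemma iter_qcomm (R : realType) (E : lmodType R[i]) (c : R[i]) (A B : E -> E) m n x :
  lin A -> lin B -> (forall y, A (B y) = c *: B (A y)) ->
  iter m A (iter n B x) = c ^+ (m * n) *: iter n B (iter m A x).
Proof.
move=> lA lB h.
have h1 p y : A (iter p B y) = c ^+ p *: iter p B (A y).
  elim: p => [|p IH] /=; first by rewrite scale1r.
  by rewrite h IH (linZ lB) scalerA -exprS.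
elim: m => [|m IH] /=; first by rewrite scale1r.
by rewrite IH (linZ lA) h1 scalerA -exprD mulSnr.
Qed.

(** * Collecting the negative powers on the left *)

Section Reordering.
Variables (R : realType) (K : lmodType R[i]) (I : eqType) (Q : I -> I -> R[i]).
Variables (W Wi : I -> K -> K) (J : Type) (alpha : J -> I) (m : J -> int).
Hypotheses (qW : qtuple Q W) (WK : forall i, cancel (W i) (Wi i))
  (WiK : forall i, cancel (Wi i) (W i)).
Hypothesis (Q0 : forall i j, Q i j != 0).

Definition swap_coef (j l : J) : R[i] :=
  (Q (alpha j) (alpha l) ^+ (ipos (m j) * ineg (m l)))^-1.

Fixpoint reorder_coef (s : seq J) : R[i] :=
  if s is j :: s' then (\prod_(l <- s') swap_coef j l) * reorder_coef s' else 1.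

Lemma Wi_lin i : lin (Wi i). Proof. exact: inverse_lin (qlin qW i) (WK i) (WiK i). Qed.

Lemma W_Wi_comm i j x : W i (Wi j x) = (Q i j)^-1 *: Wi j (W i x).
Proof.
apply: (can_inj (WK j)); rewrite (linZ (qlin qW j)) WiK.
have := qcomm qW i j (Wi j x); rewrite WiK => ->.
by rewrite scalerA mulVf // scale1r.
Qed.

Lemma ipos_comm j (s : seq J) y :
  iter (ipos (m j)) (W (alpha j)) (opprod [seq iter (ineg (m l)) (Wi (alpha l)) | l <- s] y) =
  (\prod_(l <- s) swap_coef j l) *:
    opprod [seq iter (ineg (m l)) (Wi (alpha l)) | l <- s] (iter (ipos (m j)) (W (alpha j)) y).
Proof.
elim: s => [|l s IH] /=; first by rewrite big_nil scale1r.
rewrite -/(opprod _) (iter_qcomm _ _ _ (qlin qW _) (Wi_lin _) (W_Wi_comm _ _)).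
by rewrite IH (linZ (lin_iter _ (Wi_lin _))) scalerA big_cons /swap_coef exprVn.
Qed.

(** A scalar arises only when a positive power of an earlier factor passes a negative power of a
    later one; these are the factors in the definition of regularity. *)
Lemma opprod_reorder s z :
  opprod [seq zpow (W (alpha j)) (Wi (alpha j)) (m j) | j <- s] z =
  reorder_coef s *: opprod [seq iter (ineg (m j)) (Wi (alpha j)) | j <- s]
                      (opprod [seq iter (ipos (m j)) (W (alpha j)) | j <- s] z).
Proof.
have zpowE j y : zpow (W (alpha j)) (Wi (alpha j)) (m j) y =
    iter (ineg (m j)) (Wi (alpha j)) (iter (ipos (m j)) (W (alpha j)) y) by case: (m j).
elim: s => [|j s IH]; first by rewrite /= scale1r.
transitivity (zpow (W (alpha j)) (Wi (alpha j)) (m j)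
    (opprod [seq zpow (W (alpha l)) (Wi (alpha l)) (m l) | l <- s] z)); first by [].
rewrite zpowE IH (linZ (lin_iter _ (qlin qW _))) ipos_comm.
by rewrite !(linZ (lin_iter _ (Wi_lin _))) scalerA mulrC.
Qed.
End Reordering.

(** The enumeration of the ordinals is increasing, so [i < j] means that [j] comes later in the
    list. The right side is written to agree with [reorder_coef] by conversion. *)
Lemma prod_pairs_sorted (K : comNzRingType) (r : nat) (F : 'I_r -> 'I_r -> K) :
  \prod_(i < r) \prod_(j < r | (i < j)%N) F i j =
  (fix coef s := if s is i :: s' then (\prod_(j <- s') F i j) * coef s' else 1) (enum 'I_r).
Proof.
transitivity (\prod_(i <- enum 'I_r) \prod_(j <- enum 'I_r | (i < j)%N) F i j).
  rewrite big_enum; apply: eq_bigr => i _.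
  by rewrite [RHS]big_mkcond big_enum -big_mkcond.
have : sorted ltn [seq val i | i <- enum 'I_r] by rewrite val_enum_ord iota_ltn_sorted.
elim: (enum 'I_r) => [|i s IH] /=; first by rewrite big_nil.
rewrite path_sortedE; last exact: ltn_trans.
move=> /andP[/allP ai /IH {}IH].
have lt_i j : j \in s -> (i < j)%N by move=> js; apply: ai; apply: map_f.
rewrite big_cons big_cons ltnn -IH; congr (_ * _).
  by rewrite big_seq_cond [RHS]big_seq; apply: eq_bigl => j; case: (boolP (j \in s)) => // /lt_i ->.
rewrite big_seq [RHS]big_seq; apply: eq_bigr => j /lt_i ij.
by rewrite big_cons ltnNge (ltnW ij).
Qed.

Section QFull.
Variables (R : realType) (k : nat) (q : 'I_k -> 'I_k -> R[i]).
Hypothesis q1 : forall i j : 'I_k, (i < j)%N -> `|q i j| = 1.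
Local Notation Q := (qfull q).

Lemma q_neq0 (i j : 'I_k) : (i < j)%N -> q i j != 0.
Proof. by move=> /q1 h; rewrite -normr_eq0 h oner_eq0. Qed.

Lemma qfull_inv i j : Q i j * Q j i = 1.
Proof.
rewrite /qfull; case: (ltngtP i j) => h; last by rewrite mulr1.
  by rewrite divff // q_neq0.
by rewrite mulVf // q_neq0.
Qed.

Lemma qfull_unimod i j : Q i j * (Q i j)^* = 1.
Proof.
rewrite -normCK /qfull; case: (ltngtP i j) => h.
- by rewrite q1 // expr1n.
- by rewrite normfV q1 // invr1 expr1n.
- by rewrite normr1 expr1n.
Qed.

Lemma qfull_diag i : Q i i = 1.
Proof. by rewrite /qfull ltnn. Qed.

Lemma qfull_qtuple (E : lmodType R[i]) (T : 'I_k -> E -> E) : (forall i, lin (T i)) ->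
  (forall i j : 'I_k, (i < j)%N -> forall x, T i (T j x) = q i j *: T j (T i x)) ->
  qtuple Q T.
Proof.
move=> lT h; split=> // i j x; rewrite /qfull; case: (ltngtP i j) => ij.
- exact: h.
- by rewrite (h _ _ ij) scalerA mulVf ?scale1r // q_neq0.
- by rewrite (ord_inj ij) scale1r.
Qed.

(** For [j < i] the relation is the adjoint of the one given for [(j, i)]; unimodularity identifies
    the scalars. *)
Lemma qfull_doubly (H : hilbert R) (T Ts : 'I_k -> H -> H) :
  (forall i, is_adjoint (T i) (Ts i)) ->
  (forall i j : 'I_k, (i < j)%N -> forall x : H, T i (Ts j x) = (q i j)^* *: Ts j (T i x)) ->
  forall i j x, i != j -> T i (Ts j x) = (Q i j)^* *: Ts j (T i x).
Proof.
move=> adj h i j x; rewrite /qfull; case: (ltngtP i j) => ij ne.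
- exact: h.
- have hB := hdot_hform H.
  have adj' l y z : hdot (Ts l y) z = hdot y (T l z).
    by rewrite hdotC -adj -hdotC.
  have inj u v : (forall z : H, hdot u z = hdot v z) -> u = v.
    move=> e; apply/eqP; rewrite -subr_eq0; apply/eqP/hdot_eq0.
    by rewrite (hfBl hB) e subrr.
  apply: inj => z; rewrite adj adj' (h _ _ ij) (hfZr hB) conjCK (hfZl hB) adj' -adj.
  congr (_ * _); apply: (mulfI (invr_neq0 (q_neq0 ij))); rewrite mulVf ?q_neq0 //.
  by have := qfull_unimod i j; rewrite /qfull ltnNge (ltnW ij) /= ij.
- by rewrite (ord_inj ij) eqxx in ne.
Qed.
End QFull.

Lemma regular_dilation_of_brehmer (R : realType) (H : hilbert R) (k : nat)
  (q : 'I_k -> 'I_k -> R[i]) (T Ts : 'I_k -> H -> H) :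
  (forall i j : 'I_k, (i < j)%N -> `|q i j| = 1) ->
  (forall i, is_adjoint (T i) (Ts i)) ->
  qtuple (qfull q) T -> brehmer (@hdot R H) T ->
  regular_q_unitary_dilation q T Ts.
Proof.
move=> q1 adj qT bT; have hB := hdot_hform H.
have Qu := qfull_unimod q1; have QC := qfull_inv q1; have Qd := qfull_diag q.
have [F [B [U [V0 [[hB' qU bU] lV wV uU]]]]] :=
  qtuple_dilation_seq Qu Qd QC (enum 'I_k) hB qT bT.
have {}uU i : unitary_on B (U i) by apply: uU; rewrite mem_enum.
have [K [J [W [Wi [lJ dJ WJ qW uW]]]]] :=
  completion_exists Qu hB' (bU [::] isT) qU uU.
have hK := hdot_hform K.
have WK i : cancel (W i) (Wi i) by have [] := uW i.
have WiK i : cancel (Wi i) (W i) by have [] := uW i.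
have iW i : isometric (@hdot R K) (W i) by have [] := uW i.
pose V x := J (V0 x).
have lVV : lin V by move=> a x y; rewrite /V lV lJ.
have foldJ w x : foldr W (J x) w = J (foldr U x w).
  by elim: w => [//|i w /= ->]; rewrite WJ.
have dV w1 w2 x y : (forall a, a \in w1 -> a \notin w2) ->
    hdot (foldr W (V x) w1) (foldr W (V y) w2) = hdot (foldr T x w1) (foldr T y w2).
  by move=> h; rewrite /V !foldJ dJ wV.
have dV0 x y : hdot (V x) (V y) = hdot x y by exact: (dV [::] [::]).
exists K, V, W, Wi; split; first by split=> // x; rewrite /hnorm dV0.
split.
  move=> i; split; last by split.
  by split=> [|x]; [exact: (qlin qW)|rewrite /hnorm iW].
split; first by move=> i j _ x; exact: (qcomm qW).
move=> r alpha m inj x; split; first by eexists.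
move=> h; rewrite (hfBl hK) dV0 (hfZl hB).
rewrite (opprod_reorder _ _ qW WK WiK (Q_neq0 QC)) (hfZl hK) prod_pairs_sorted.
rewrite !opprod_iter.
(* The adjoint of [Wi] is [W], as that of [Ts] is [T]: on both spaces the negative powers become a
   word acting on the second argument. *)
rewrite (foldr_adjoint (A := W)); last first.
  by move=> i y z; rewrite -(iW i (Wi i y)) WiK.
rewrite (foldr_adjoint (A := T)); last first.
  by move=> i y z; rewrite hdotC -adj -hdotC.
(* A common letter would, by injectivity of [alpha], come from one index whose exponent has both
   parts nonzero. *)
rewrite dV ?subrr // => a /flattenP[_ /mapP[i _ ->]] /nseqP[-> ip].
rewrite mem_rev; apply/negP => /flattenP[_ /mapP[j _ ->]] /nseqP[/inj ij jp].
by move: ip jp; rewrite ij; case: (m j).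
Qed.

Theorem theorem4p9 (R : realType) (H : hilbert R) (k : nat)
  (T Ts : 'I_k -> H -> H) (q : 'I_k -> 'I_k -> R[i]) :
  (forall i, hcontraction (T i)) ->
  (forall i, is_adjoint (T i) (Ts i)) ->
  (forall i j : 'I_k, (i < j)%N -> `|q i j| = 1) ->
  (forall i j : 'I_k, (i < j)%N -> forall x : H, T i (T j x) = q i j *: T j (T i x)) ->
  (* (1) isometries *)
  ((forall i, hisometry (T i))
   (* (2) doubly q-commuting *)
   \/ (forall i j : 'I_k, (i < j)%N -> forall x : H, T i (Ts j x) = (q i j)^* *: Ts j (T i x))
   (* (3) norm condition *)
   \/ \sum_(i < k) opnorm (T i) ^+ 2 <= 1) ->
  regular_q_unitary_dilation q T Ts.
Proof.
move=> cT adj q1 qT cases; have lT i : lin (T i) by case: (cT i).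
have hB := hdot_hform H; have pB := @hdot_psd R H.
have qQ := qfull_qtuple q1 lT qT.
apply: regular_dilation_of_brehmer => //.
case: cases => [iT|[dT|nT]].
- apply: brehmer_isometric => // i x.
  by rewrite -!(nf_sq pB) -!hnormE (proj2 (iT i)).
- apply: (brehmer_doubly hB pB lT (Q := qfull q) (S := Ts)) => //.
  + by move=> i j x _; exact: (qcomm qQ).
  + exact: qfull_doubly.
  + by move=> i x; have [_] := cT i; apply.
apply: (brehmer_sum_le1 pB _ nT) => [i|i x]; first exact: sqr_ge0.
have h := opnorm_le x (cT i).
by rewrite -!(nf_sq pB) -exprMn ler_pXn2r ?nnegrE ?(le_trans _ h) ?nf_ge0.
Qed.
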